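(* If $s=1$, then the problem $1|jrp,r_j|F_{\max}+c_\mathcal{Q}$ can be solved in polynomial time.
   Context: Problem $1|jrp,s=1,r_j|F_{\max}+c_\mathcal{Q}$: a set $\mathcal{J}$ of $n$ jobs must be processed non-preemptively on a single machine that processes at most one job at a time. Job $j$ has processing time $p_j>0$ and release date $r_j\ge 0$. There is a single resource $R$, required by every job, and nonnegative costs $K_0,K_1$. A solution is a pair $(S,\mathcal{Q})$, where $S$ assigns a start time $S_j$ to each job (completion time $C_j=S_j+p_j$) and $\mathcal{Q}$ is a finite set of replenishment times $t_1<\dots<t_q$ at which $R$ is replenished. Job $j$ is ready to be started at time $t$ if some replenishment time lies in $[r_j,t]$. The solution is feasible if no two jobs overlap and each job $j$ is ready to be started at $S_j$. The goal is to minimize $F_{\max}+q(K_0+K_1)$, where $F_{\max}=\max_j(C_j-r_j)$. *)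

(* Defs.v *)
From HB Require Import structures.
From mathcomp Require Import all_boot all_order all_algebra.
Set Implicit Arguments.
Unset Strict Implicit.
Unset Printing Implicit Defensive.
Import Order.TTheory GRing.Theory Num.Theory.

(** * Polynomial time: random access machines, logarithmic cost criterion *)

(* The RAM of Aho, Hopcroft and Ullman (a read-only input tape, a write-only
   output tape, unboundedly many cells holding natural numbers, indirect
   addressing), with structured control flow instead of jumps.  Every operation
   is charged the bit lengths of all the numbers and addresses it handles, so
   that polynomial time is the same notion as for Turing machines. *)

(* floor (log2 n) + 1 for n > 0, and 1 for n = 0 *)
Definition bitlen (n : nat) : nat := (trunc_log 2 n).+1.

Definition wordlen (w : seq nat) : nat := sumn [seq bitlen n | n <- w].

Inductive expr : Type :=
  | Cst of nat
  | Cell of expr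
  | Add of expr & expr
  | Sub of expr & expr
  | Mul of expr & expr
  | Div of expr & expr.

Inductive com : Type :=
  | Skip
  | Store of expr & expr
  | Read of expr
  | Write of expr
  | Seq of com & com
  | If of expr & com & com
  | While of expr & com.

Record state : Type :=
  State { mem : nat -> nat; inp : seq nat; out : seq nat }.

Definition init (w : seq nat) : state := State (fun=> 0) w [::].

Definition upd (m : nat -> nat) (a v : nat) : nat -> nat :=
  fun i => if i == a then v else m i.

(* [Sub] is truncated subtraction, and division by 0 yields 0. *)
Fixpoint eval (m : nat -> nat) (e : expr) : nat :=
  match e with
  | Cst n => n
  | Cell e1 => m (eval m e1)
  | Add e1 e2 => eval m e1 + eval m e2
  | Sub e1 e2 => eval m e1 - eval m e2
  | Mul e1 e2 => eval m e1 * eval m e2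
  | Div e1 e2 => eval m e1 %/ eval m e2
  end.

Fixpoint ecost (m : nat -> nat) (e : expr) : nat :=
  match e with
  | Cst n => bitlen n
  | Cell e1 => ecost m e1 + bitlen (eval m e1) + bitlen (m (eval m e1))
  | Add e1 e2 | Sub e1 e2 | Mul e1 e2 | Div e1 e2 =>
      ecost m e1 + ecost m e2 + bitlen (eval m e1) + bitlen (eval m e2)
  end.

(* [exec c s s' t]: started in state s, the program c halts in state s' after
   time t.  Conditions hold when their value is nonzero; reading past the end
   of the input yields 0. *)
Inductive exec : com -> state -> state -> nat -> Prop :=
  | ExecSkip s : exec Skip s s 1
  | ExecStore a e s :
      exec (Store a e) s
        (State (upd (mem s) (eval (mem s) a) (eval (mem s) e)) (inp s) (out s))
        (ecost (mem s) a + ecost (mem s) e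
         + bitlen (eval (mem s) a) + bitlen (eval (mem s) e))
  | ExecRead a s :
      exec (Read a) s
        (State (upd (mem s) (eval (mem s) a) (head 0 (inp s)))
               (behead (inp s)) (out s))
        (ecost (mem s) a + bitlen (eval (mem s) a) + bitlen (head 0 (inp s)))
  | ExecWrite e s :
      exec (Write e) s
        (State (mem s) (inp s) (rcons (out s) (eval (mem s) e)))
        (ecost (mem s) e + bitlen (eval (mem s) e))
  | ExecSeq c1 c2 s1 s2 s3 t1 t2 :
      exec c1 s1 s2 t1 -> exec c2 s2 s3 t2 -> exec (Seq c1 c2) s1 s3 (t1 + t2)
  | ExecIfT e c1 c2 s s' t :
      eval (mem s) e != 0 -> exec c1 s s' t ->
      exec (If e c1 c2) s s' (ecost (mem s) e + t)
  | ExecIfF e c1 c2 s s' t :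
      eval (mem s) e = 0 -> exec c2 s s' t ->
      exec (If e c1 c2) s s' (ecost (mem s) e + t)
  | ExecWhileT e c s1 s2 s3 t1 t2 :
      eval (mem s1) e != 0 -> exec c s1 s2 t1 -> exec (While e c) s2 s3 t2 ->
      exec (While e c) s1 s3 (ecost (mem s1) e + t1 + t2)
  | ExecWhileF e c s :
      eval (mem s) e = 0 -> exec (While e c) s s (ecost (mem s) e).

Lemma exec_det c s s1 s2 t1 t2 :
  exec c s s1 t1 -> exec c s s2 t2 -> s1 = s2 /\ t1 = t2.
Proof.
move=> E; elim: E s2 t2 => {c s s1 t1}.
- by move=> s s2 t2 E; inversion E.
- by move=> a e s s2 t2 E; inversion E.
- by move=> a s s2 t2 E; inversion E.
- by move=> e s s2 t2 E; inversion E.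
- move=> c1 c2 s1 s2 s3 t1 t2 _ IH1 _ IH2 s4 t4 E.
  inversion E as [| | | |? ? ? u ? ? ? E1 E2| | | |]; subst.
  by have [? ?] := IH1 _ _ E1; subst; have [-> ->] := IH2 _ _ E2.
- move=> e c1 c2 s s' t nz _ IH s2 t2 E.
  inversion E as [| | | | |? ? ? ? ? ? _ E1|? ? ? ? ? ? z| |]; subst.
    by have [-> ->] := IH _ _ E1.
  by rewrite z in nz.
- move=> e c1 c2 s s' t z _ IH s2 t2 E.
  inversion E as [| | | | |? ? ? ? ? ? nz|? ? ? ? ? ? _ E1| |]; subst.
    by rewrite z in nz.
  by have [-> ->] := IH _ _ E1.
- move=> e c s1 s2 s3 t1 t2 nz _ IH1 _ IH2 s4 t4 E.
  inversion E as [| | | | | | |? ? ? u ? ? ? _ E1 E2|? ? ? z]; subst.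
    by have [? ?] := IH1 _ _ E1; subst; have [-> ->] := IH2 _ _ E2.
  by rewrite z in nz.
- move=> e c s z s2 t2 E.
  inversion E as [| | | | | | |? ? ? ? ? ? ? nz|]; subst => //.
  by rewrite z in nz.
Qed.

(* A search problem: instances I, candidate solutions O x of an instance x, and
   the set [good x] of the sought solutions; [ein] and [eout] say which words
   represent an instance, respectively a candidate solution. *)
Definition poly_time_solvable (I : Type) (O : I -> Type)
    (ein : I -> seq nat -> Prop) (eout : forall x, O x -> seq nat -> Prop)
    (good : forall x, O x -> Prop) : Prop :=
  exists (c : com) (k : nat),
    forall (x : I) (w : seq nat), ein x w ->
      exists (s : state) (t : nat) (y : O x),
        [/\ exec c (init w) s t,
            t <= k * wordlen w ^ k + k,
            eout x y (out s)
          & good x y].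

(** * The scheduling problem *)

Local Open Scope ring_scope.

Record instance (R : realFieldType) : Type := Instance {
  njobs : nat;
  proc : 'I_njobs -> R;
  release : 'I_njobs -> R;
  K0 : R;
  K1 : R;
  proc_gt0 : forall j, 0 < proc j;
  release_ge0 : forall j, 0 <= release j;
  K0_ge0 : 0 <= K0;
  K1_ge0 : 0 <= K1
}.

Record solution (R : realFieldType) (x : instance R) : Type := Solution {
  start : 'I_(njobs x) -> R;
  repl : seq R
}.

Section Problem.
Variables (R : realFieldType) (x : instance R).
Implicit Type y : solution x.

Definition completion y (j : 'I_(njobs x)) : R := start y j + proc j.

Definition ready y (j : 'I_(njobs x)) (t : R) : Prop :=
  exists2 u, u \in repl y & release j <= u <= t.

Definition feasible y : Prop :=
  [/\ sorted <%R (repl y),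
      forall i j, i != j ->
        completion y i <= start y j \/ completion y j <= start y i
    & forall j, ready y j (start y j)].

(* The neutral element 0 only matters without jobs: the flow times of a
   feasible solution are positive. *)
Definition Fmax y : R :=
  \big[Num.max/0]_(j < njobs x) (completion y j - release j).

Definition cost y : R := Fmax y + (size (repl y))%:R * (K0 x + K1 x).

Definition optimal y : Prop :=
  feasible y /\ forall z : solution x, feasible z -> cost y <= cost z.

End Problem.

(* Numbers are written as (not necessarily reduced) fractions of naturals in
   binary; only nonnegative rationals have a representation. *)
Definition enc_nums (R : realFieldType) (v : seq R) (w : seq nat) : Prop :=
  exists f : seq (nat * nat),
    [/\ all (fun a => 0 < a.2)%N f,
        v = [seq a.1%:R / a.2%:R | a <- f]
      & w = flatten [seq [:: a.1; a.2] | a <- f]].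

Definition enc_instance (R : realFieldType) (x : instance R) (w : seq nat) :
    Prop :=
  exists2 u, enc_nums ([:: K0 x; K1 x] ++ codom (@proc R x)
                         ++ codom (@release R x)) u
           & w = njobs x :: u.

Definition enc_solution (R : realFieldType) (x : instance R) (y : solution x)
    (w : seq nat) : Prop :=
  exists2 u, enc_nums (codom (start y) ++ repl y) u
           & w = size (repl y) :: u.

(* Main.v *)
Require Import Defs.
From HB Require Import structures.
From mathcomp Require Import all_boot all_order all_algebra.
From mathcomp Require Import zify ring lra.
(* MathComp has its own [Sub] and [mem]. *)
Import Defs.
Set Implicit Arguments.
Unset Strict Implicit.
Unset Printing Implicit Defensive.

(** After scaling to integers, order the jobs by release date. In a schedule
    with maximal flow time F, for every job j and every k after it, the jobs
    from j to k are finished by r_k + F; so the first of them to start does so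
    by r_k + F - (p_j + ... + p_k), after a replenishment that is not earlier
    than r_j. Minimising over k, some replenishment lies between r_j and
    L_j = F + a_j, where a_j does not depend on F. Conversely all jobs can be
    started at their L_j. For a given F it thus remains to stab the intervals
    from r_j to L_j by as few points as possible, which the greedy algorithm
    does. As replenishments may be moved back to release dates, only the values
    r_i - a_k have to be tried for F.

    On the machine side, the functions computable in polynomial time by programs
    that respect a fixed memory layout are closed under arithmetic and under
    loops over the jobs in which each step multiplies the running value by a
    bounded factor. The algorithm is a composition of such functions; every
    quantity is recomputed whenever it is needed. *)

(** * Bit lengths and execution times *)

Local Arguments bitlen : simpl never.

Lemma bitlen_gt0 n : 0 < bitlen n.
Proof. by []. Qed.

(** Reduces the estimates of bit lengths below to comparisons of powers of 2. For [b = 0] it would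
    fail at [n = 0], since [bitlen 0] is 1. *)
Lemma bitlen_leE n b : 0 < b -> (bitlen n <= b) = (n < 2 ^ b).
Proof.
case: b => // b _; apply/idP/idP => [le_nb | lt_n].
  by apply: leq_trans (trunc_log_ltn n (isT : 1 < 2)) _; rewrite leq_exp2l.
case: (posnP n) => [->|n_gt0]; first by rewrite /bitlen trunc_log0.
rewrite /bitlen ltnS -ltnS -(@ltn_exp2l 2) //.
exact: leq_ltn_trans (trunc_logP (isT : 1 < 2) n_gt0) lt_n.
Qed.

Lemma ltn_bitlen n : n < 2 ^ bitlen n.
Proof. by rewrite -bitlen_leE. Qed.

Lemma leq_bitlen m n : m <= n -> bitlen m <= bitlen n.
Proof. by move=> le_mn; rewrite bitlen_leE // (leq_ltn_trans le_mn) ?ltn_bitlen. Qed.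

Lemma bitlen_leq m n : m <= n -> 0 < n -> bitlen m <= n.
Proof.
move=> le_mn n_gt0; rewrite bitlen_leE //.
exact: leq_ltn_trans le_mn (ltn_expl n (isT : 1 < 2)).
Qed.

Lemma bitlenD m n : bitlen (m + n) <= bitlen m + bitlen n.
Proof.
rewrite bitlen_leE // expnD; have := ltn_bitlen m; have := ltn_bitlen n.
have: 2 <= 2 ^ bitlen m by rewrite -{1}(expn1 2) leq_exp2l.
have: 2 <= 2 ^ bitlen n by rewrite -{1}(expn1 2) leq_exp2l.
nia.
Qed.

Lemma bitlenM m n : bitlen (m * n) <= bitlen m + bitlen n.
Proof. by rewrite bitlen_leE // expnD; apply: ltn_mul; apply: ltn_bitlen. Qed.

Lemma bitlenS n : bitlen n.+1 <= (bitlen n).+1.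
Proof.
rewrite bitlen_leE // expnS; have := ltn_bitlen n.
have: 2 <= 2 ^ bitlen n by rewrite -{1}(expn1 2) leq_exp2l.
lia.
Qed.

(** Fixed addresses and constants of the code are paid for by the exponent, since [k < W ^ k]. *)
Lemma bitlen_expn W n k : 1 < W -> n <= k -> bitlen n <= W ^ k.
Proof.
move=> W2 le_nk; have W_gt0 : 0 < W ^ k by rewrite expn_gt0 (ltnW W2).
apply: bitlen_leq => //; apply: leq_trans le_nk _; exact: ltnW (ltn_expl _ W2).
Qed.

(** Constant factors go into the exponent as well: [c <= 2 ^ j <= W ^ j]. Time bounds can thus keep
    the plain form [W ^ k]. *)
Lemma leq_mul_expn W c j a : 1 < W -> c <= 2 ^ j -> c * W ^ a <= W ^ (a + j).
Proof.
move=> W2 le_c; rewrite addnC expnD leq_mul2r; apply/orP; right.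
by case: j le_c => [|j] le_c; rewrite ?expn0 // (leq_trans le_c) // leq_exp2r.
Qed.

(** When all constants and all cell contents read have at most [W] bits, [eweight e * W] bounds the
    bit length of the value of [e], and [ecoef e * W] the cost of evaluating it: addition and
    multiplication at most add bit lengths, subtraction and division do not exceed that of the first
    operand. *)
Fixpoint eweight (e : expr) : nat :=
  match e with
  | Cst _ | Cell _ => 1
  | Add e1 e2 | Sub e1 e2 | Mul e1 e2 | Div e1 e2 => eweight e1 + eweight e2
  end.

Fixpoint ecoef (e : expr) : nat :=
  match e with
  | Cst _ => 1
  | Cell e1 => ecoef e1 + eweight e1 + 1
  | Add e1 e2 | Sub e1 e2 | Mul e1 e2 | Div e1 e2 =>
      ecoef e1 + ecoef e2 + eweight e1 + eweight e2
  end.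

Fixpoint ebounded (m : nat -> nat) (W : nat) (e : expr) : bool :=
  match e with
  | Cst n => bitlen n <= W
  | Cell e1 => ebounded m W e1 && (bitlen (m (eval m e1)) <= W)
  | Add e1 e2 | Sub e1 e2 | Mul e1 e2 | Div e1 e2 =>
      ebounded m W e1 && ebounded m W e2
  end.

Lemma ebounded_leq m W e : ebounded m W e ->
  bitlen (eval m e) <= eweight e * W /\ ecost m e <= ecoef e * W.
Proof.
have binop (o : nat -> nat -> nat) e1 e2 :
    (forall a b, bitlen (o a b) <= bitlen a + bitlen b) ->
    (ebounded m W e1 -> bitlen (eval m e1) <= eweight e1 * W /\
       ecost m e1 <= ecoef e1 * W) ->
    (ebounded m W e2 -> bitlen (eval m e2) <= eweight e2 * W /\
       ecost m e2 <= ecoef e2 * W) ->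
    ebounded m W e1 && ebounded m W e2 ->
    bitlen (o (eval m e1) (eval m e2)) <= (eweight e1 + eweight e2) * W /\
    ecost m e1 + ecost m e2 + bitlen (eval m e1) + bitlen (eval m e2) <=
      (ecoef e1 + ecoef e2 + eweight e1 + eweight e2) * W.
  move=> ob IH1 IH2 /andP[/IH1[v1 c1] /IH2[v2 c2]].
  have := ob (eval m e1) (eval m e2); rewrite !mulnDl; lia.
elim: e => /=.
- by move=> n le_n; rewrite !mul1n.
- by move=> e IH /andP[/IH[v c] le_m]; rewrite !mulnDl mul1n; lia.
- by move=> e1 IH1 e2 IH2; apply: (binop addn) IH1 IH2 => a b; apply: bitlenD.
- move=> e1 IH1 e2 IH2; apply: (binop subn) IH1 IH2 => a b.
  by rewrite (leq_trans (leq_bitlen (leq_subr b a))) ?leq_addr.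
- by move=> e1 IH1 e2 IH2; apply: (binop muln) IH1 IH2 => a b; apply: bitlenM.
- move=> e1 IH1 e2 IH2; apply: (binop divn) IH1 IH2 => a b.
  by rewrite (leq_trans (leq_bitlen (leq_div a b))) ?leq_addr.
Qed.

Lemma exec_store m i o a e W : ebounded m W a -> ebounded m W e ->
  exists2 t, exec (Store a e) (State m i o)
                  (State (upd m (eval m a) (eval m e)) i o) t
    & t <= (ecoef a + ecoef e + eweight a + eweight e) * W.
Proof.
move=> /ebounded_leq[va ca] /ebounded_leq[ve ce].
eexists; first exact: ExecStore.
by rewrite /= !mulnDl; lia.
Qed.

(** The test counts the remaining rounds, so one induction on its value yields both termination and
    the time bound. *)
Lemma exec_while (Inv : nat -> state -> Prop) e c N B G :
  (forall i s, i <= N -> Inv i s ->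
     eval (mem s) e = N - i /\ ecost (mem s) e <= G) ->
  (forall i s, i < N -> Inv i s ->
     exists s' t, [/\ exec c s s' t, t <= B & Inv i.+1 s']) ->
  forall s, Inv 0 s ->
  exists s' t, [/\ exec (While e c) s s' t, t <= N * (G + B) + G & Inv N s'].
Proof.
move=> He Hc s; suff: forall k i s, i + k = N -> Inv i s ->
    exists s' t, [/\ exec (While e c) s s' t, t <= k * (G + B) + G & Inv N s'].
  by apply.
elim=> {s} [|k IH] i s.
  rewrite addn0 => -> inv; have [ev ec] := He _ _ (leqnn N) inv.
  by exists s, (ecost (mem s) e); split=> //; apply: ExecWhileF; rewrite ev subnn.
move=> ik inv; have lt_iN : i < N by lia.
have [ev ec] := He _ _ (ltnW lt_iN) inv.
have [s1 [t1 [E1 le1 inv1]]] := Hc _ _ lt_iN inv.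
have [s2 [t2 [E2 le2 inv2]]] := IH i.+1 s1 ltac:(lia) inv1.
exists s2, (ecost (mem s) e + t1 + t2); split=> //.
  by apply: ExecWhileT E1 E2; rewrite ev; lia.
by rewrite mulSn; lia.
Qed.

(** * Functions computable in polynomial time *)

(* The memory holds three interleaved arrays: intermediate results, loop
   variables, and a copy of the input word. *)
Definition tmp d := 3 * d.
Definition var k := 3 * k + 1.
Definition wrd i := 3 * i + 2.

Section Computable.
Variables (G : Type) (wd : G -> seq nat) (rho : seq (G -> nat)).

Definition njob (w : seq nat) := nth 0 w 0.

(* The cells [var a], a in [al], hold the values of the variables [rho]. *)
Definition stored (al : seq nat) g (m : nat -> nat) : Prop :=
  (forall i, m (wrd i) = nth 0 (wd g) i) /\
  [seq m (var a) | a <- al] = [seq h g | h <- rho].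

(** [W] is the size against which time is measured. Bounding [njob (wd g)] itself, not only its bit
    length, is what makes loops over the jobs polynomial; [1 < W] lets constants be absorbed in
    powers of [W]. *)
Definition small W g : Prop :=
  [/\ 1 < W, njob (wd g) <= W,
      forall i, bitlen (nth 0 (wd g) i) <= W
    & all (fun h => bitlen (h g) <= W) rho].

Definition frame l d (m m' : nat -> nat) : Prop :=
  forall i, [/\ i < d -> m' (tmp i) = m (tmp i),
                i < l -> m' (var i) = m (var i)
              & m' (wrd i) = m (wrd i)].

(* The code leaves the result in [tmp d] and may only change the cells [tmp i]
   for [i >= d] and [var i] for [i >= l]. *)
Definition polyfun (f : G -> nat) : Prop :=
  forall l al d, all (ltn^~ l) al -> exists c k, forall g W m i o,
    small W g -> stored al g m ->
    exists m' t, [/\ exec c (State m i o) (State m' i o) t, t <= W ^ k,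
                     m' (tmp d) = f g, bitlen (f g) <= W ^ k & frame l d m m'].

Definition polyout (f : G -> seq nat) : Prop :=
  forall l al, all (ltn^~ l) al -> exists c k, forall g W m i o,
    small W g -> stored al g m ->
    exists m' t, [/\ exec c (State m i o) (State m' i (o ++ f g)) t, t <= W ^ k
                   & frame l 0 m m'].

End Computable.

Lemma frame_sub l d l' d' m m' : l <= l' -> d <= d' ->
  frame l' d' m m' -> frame l d m m'.
Proof.
move=> ll dd fr i; have [ft fv fw] := fr i; split=> // lt_i.
  by apply: ft; apply: leq_trans dd.
by apply: fv; apply: leq_trans ll.
Qed.

Lemma frame_trans l d m1 m2 m3 :
  frame l d m1 m2 -> frame l d m2 m3 -> frame l d m1 m3.
Proof.
move=> f1 f2 i; have [t1 v1 w1] := f1 i; have [t2 v2 w2] := f2 i.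
by split=> [lt_i|lt_i|]; rewrite ?t2 ?t1 ?v2 ?v1 ?w2.
Qed.

Lemma frame_updt l d d' m v : d <= d' -> frame l d m (upd m (tmp d') v).
Proof. by move=> dd i; rewrite /upd /tmp /var /wrd; split=> *; case: eqP => //; lia. Qed.

Lemma frame_updv l l' d m v : l <= l' -> frame l d m (upd m (var l') v).
Proof. by move=> dd i; rewrite /upd /tmp /var /wrd; split=> *; case: eqP => //; lia. Qed.

Lemma frame_stored G wd rho al (g : G) l d m m' :
  all (ltn^~ l) al -> frame l d m m' ->
  stored wd rho al g m -> stored wd rho al g m'.
Proof.
move=> sz fr [mw mv]; split=> [i|]; first by have [_ _ ->] := fr i.
rewrite -mv; apply/eq_in_map => a /(allP sz) lt_a.
by have [_ fv _] := fr a; rewrite fv.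
Qed.

Lemma small_leq G wd rho (g : G) W W' :
  W <= W' -> small wd rho W g -> small wd rho W' g.
Proof.
move=> le_W [W2 nW wW vW]; split=> [||i|]; try exact: leq_trans le_W.
by apply: sub_all vW => h /leq_trans; apply.
Qed.

Lemma upd_eq m a v : upd m a v a = v.
Proof. by rewrite /upd eqxx. Qed.

Lemma upd_neq m a v b : b != a -> upd m a v b = m b.
Proof. by rewrite /upd => /negPf->. Qed.

(** A loop body depends on one more number than its surroundings: [G * nat] is the enlarged context,
    and [xrho] puts the new variable first. *)
Definition xwd G (wd : G -> seq nat) (g : G * nat) : seq nat := wd g.1.
Definition xrho G (rho : seq (G -> nat)) : seq (G * nat -> nat) :=
  snd :: [seq (fun g => h g.1) | h <- rho].

Lemma xrhoE G (rho : seq (G -> nat)) g x :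
  [seq h (g, x) | h <- xrho rho] = x :: [seq h g | h <- rho].
Proof. by rewrite /= -map_comp. Qed.

Lemma small_x G wd rho (g : G) x W :
  small (xwd wd) (xrho rho) W (g, x) <-> small wd rho W g /\ bitlen x <= W.
Proof.
rewrite /small /xrho /= all_map; split.
  by move=> [? ? ? /andP[]].
by move=> [[? ? ? ?] ?]; split=> //; apply/andP.
Qed.

Lemma stored_x G wd rho al a (g : G) x m :
  stored (xwd wd) (xrho rho) (a :: al) (g, x) m <->
  stored wd rho al g m /\ m (var a) = x.
Proof.
rewrite /stored xrhoE /=; split; first by move=> [? [? ?]].
by move=> [[? ->] ->].
Qed.

(** * Closure under arithmetic and access to the input word *)

Section Rules.
Variables (G : Type) (wd : G -> seq nat) (rho : seq (G -> nat)).
Local Notation pfun := (polyfun wd rho).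

Lemma polyfun_ext f f' : pfun f -> (forall g, f g = f' g) -> pfun f'.
Proof.
move=> pf eq_f l al d sz; have [c [k H]] := pf l al d sz; exists c, k => g W m i o sm st.
by rewrite -eq_f; apply: H sm st.
Qed.

Lemma polyfun_const v : pfun (fun=> v).
Proof.
move=> l al d sz; exists (Store (Cst (tmp d)) (Cst v)), (tmp d + v + 2).
move=> g W m i o [W2 _ _ _] _.
have bd : bitlen (tmp d) <= W ^ (tmp d + v) by apply: bitlen_expn => //; lia.
have bv : bitlen v <= W ^ (tmp d + v) by apply: bitlen_expn => //; lia.
have [t E le_t] := @exec_store m i o (Cst (tmp d)) (Cst v) _ bd bv.
exists (upd m (tmp d) v), t; split=> //.
- by apply: leq_trans le_t _; apply: leq_mul_expn.
- by rewrite upd_eq.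
- by apply: leq_trans bv _; rewrite leq_exp2l //; lia.
- exact: frame_updt.
Qed.

Lemma polyfun_word f : pfun f -> pfun (fun g => nth 0 (wd g) (f g)).
Proof.
move=> pf l al d sz; have [c [k H]] := pf l al d sz.
pose e := Cell (Add (Mul (Cst 3) (Cell (Cst (tmp d)))) (Cst 2)).
exists (Seq c (Store (Cst (tmp d)) e)), (k + tmp d + 3 + 6).
move=> g W m i o sm st; have [W2 _ wW _] := sm.
have [m1 [t1 [E1 le1 v1 b1 fr1]]] := H g W m i o sm st.
have st1 := frame_stored sz fr1 st.
have bd : bitlen (tmp d) <= W ^ (k + tmp d + 3) by apply: bitlen_expn => //; lia.
have be : ebounded m1 (W ^ (k + tmp d + 3)) e.
  have b3 : bitlen 3 <= W ^ (k + tmp d + 3) by apply: bitlen_expn => //; lia.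
  have b2 : bitlen 2 <= W ^ (k + tmp d + 3) by apply: bitlen_expn => //; lia.
  rewrite /= bd v1 ?b2 ?b3 /= (leq_trans b1) /=; last by rewrite leq_exp2l //; lia.
  rewrite -[3 * _ + 2]/(wrd (f g)) st1.1 (leq_trans (wW _)) //.
  by rewrite -{1}(expn1 W) leq_exp2l //; lia.
have [t2 E2 le2] := @exec_store m1 i o (Cst (tmp d)) e _ bd be.
have ev : eval m1 e = nth 0 (wd g) (f g).
  by rewrite /= v1 -[3 * _ + 2]/(wrd (f g)) st1.1.
rewrite ev /= in E2.
exists (upd m1 (tmp d) (nth 0 (wd g) (f g))), (t1 + t2); split.
- exact: ExecSeq E1 E2.
- apply: (@leq_trans (26 * W ^ (k + tmp d + 3))); last exact: leq_mul_expn.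
  have: W ^ k <= W ^ (k + tmp d + 3) by rewrite leq_exp2l //; lia.
  by rewrite /= in le2; lia.
- by rewrite upd_eq.
- by rewrite (leq_trans (wW _)) // -{1}(expn1 W) leq_exp2l //; lia.
- exact: frame_trans fr1 (frame_updt _ _ _ _).
Qed.

Lemma polyfun_binop (O : expr -> expr -> expr) (o : nat -> nat -> nat) f1 f2 :
  (forall m a b, eval m (O a b) = o (eval m a) (eval m b)) ->
  (forall m W a b, ebounded m W (O a b) = ebounded m W a && ebounded m W b) ->
  (forall a b, eweight (O a b) = eweight a + eweight b) ->
  (forall a b, ecoef (O a b) = ecoef a + ecoef b + eweight a + eweight b) ->
  pfun f1 -> pfun f2 -> pfun (fun g => o (f1 g) (f2 g)).
Proof.
move=> evO bO wO cO p1 p2 l al d sz.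
(* The second operand is computed from [tmp d.+1] on, so its frame preserves the first one in
   [tmp d]. *)
have [c1 [k1 H1]] := p1 l al d sz; have [c2 [k2 H2]] := p2 l al d.+1 sz.
pose e := O (Cell (Cst (tmp d))) (Cell (Cst (tmp d.+1))).
pose K := k1 + k2 + tmp d.+1.
exists (Seq c1 (Seq c2 (Store (Cst (tmp d)) e))), (K + 5).
move=> g W m i o' sm st; have [W2 _ _ _] := sm.
have [m1 [t1 [E1 le1 v1 b1 fr1]]] := H1 g W m i o' sm st.
have st1 := frame_stored sz fr1 st.
have [m2 [t2 [E2 le2 v2 b2 fr2]]] := H2 g W m1 i o' sm st1.
have v12 : m2 (tmp d) = f1 g by have [-> //] := fr2 d.
have le_K j : j <= K -> W ^ j <= W ^ K by move=> le_j; rewrite leq_exp2l.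
have bd : bitlen (tmp d) <= W ^ K by apply: bitlen_expn => //; rewrite /K /tmp; lia.
have bd1 : bitlen (tmp d.+1) <= W ^ K by apply: bitlen_expn => //; rewrite /K /tmp; lia.
have lk1 : W ^ k1 <= W ^ K by apply: le_K; rewrite /K; lia.
have lk2 : W ^ k2 <= W ^ K by apply: le_K; rewrite /K; lia.
have be : ebounded m2 (W ^ K) e.
  by rewrite bO /= bd bd1 v12 v2 /= (leq_trans b1) // (leq_trans b2).
have [t3 E3 le3] := @exec_store m2 i o' (Cst (tmp d)) e _ bd be.
have ev : eval m2 e = o (f1 g) (f2 g) by rewrite evO /= v12 v2.
rewrite ev /= in E3.
exists (upd m2 (tmp d) (o (f1 g) (f2 g))), (t1 + (t2 + t3)); split.
- exact: ExecSeq E1 (ExecSeq E2 E3).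
- apply: (@leq_trans (14 * W ^ K)); last exact: leq_mul_expn.
  by rewrite /= wO cO /= in le3; lia.
- by rewrite upd_eq.
- have [bv _] := ebounded_leq be; rewrite ev wO /= in bv.
  by apply: leq_trans bv _; apply: leq_mul_expn.
- apply: frame_trans fr1 (frame_trans _ (frame_updt _ _ _ _)) => //.
  exact: frame_sub fr2.
Qed.

Lemma polyfun_add f1 f2 : pfun f1 -> pfun f2 -> pfun (fun g => f1 g + f2 g).
Proof. exact: (@polyfun_binop Add). Qed.

Lemma polyfun_sub f1 f2 : pfun f1 -> pfun f2 -> pfun (fun g => f1 g - f2 g).
Proof. exact: (@polyfun_binop Sub). Qed.

Lemma polyfun_mul f1 f2 : pfun f1 -> pfun f2 -> pfun (fun g => f1 g * f2 g).
Proof. exact: (@polyfun_binop Mul). Qed.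

Lemma polyfun_div f1 f2 : pfun f1 -> pfun f2 -> pfun (fun g => f1 g %/ f2 g).
Proof. exact: (@polyfun_binop Div). Qed.

End Rules.

(** * Loop variables and loops over the jobs *)

Section Variables.
Variables (G : Type) (wd : G -> seq nat) (rho : seq (G -> nat)).

Lemma polyfun_weak f :
  polyfun wd rho f -> polyfun (xwd wd) (xrho rho) (fun g => f g.1).
Proof.
move=> pf l [|a al] d sz.
  (* Without an address for the loop variable [stored] is impossible, so any code will do. *)
  by exists Skip, 0 => g W m i o _ [_]; rewrite /xrho.
have /andP[_ sz'] := sz; have [c [k H]] := pf l al d sz'.
exists c, k => [[g x] W m i o] /small_x[sm _] /stored_x[st _].
exact: H.
Qed.

Lemma polyfun_idx : polyfun (xwd wd) (xrho rho) (fun g => g.2).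
Proof.
move=> l [|a al] d sz.
  by exists Skip, 0 => g W m i o _ [_]; rewrite /xrho.
pose K := tmp d + var a + 1.
exists (Store (Cst (tmp d)) (Cell (Cst (var a)))), (K + 3).
move=> [g x] W m i o /small_x[[W2 _ _ _] bx] /stored_x[_ mx] /=.
have bd : bitlen (tmp d) <= W ^ K by apply: bitlen_expn => //; rewrite /K; lia.
have bk : bitlen (var a) <= W ^ K by apply: bitlen_expn => //; rewrite /K; lia.
have bv : bitlen (m (var a)) <= W ^ K.
  by rewrite mx (leq_trans bx) // -{1}(expn1 W) leq_exp2l // /K; lia.
have [t E le_t] :=
  @exec_store m i o (Cst (tmp d)) (Cell (Cst (var a))) _ bd (introT andP (conj bk bv)).
exists (upd m (tmp d) (m (var a))), t; split=> //.
- by apply: leq_trans le_t _; apply: leq_mul_expn.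
- by rewrite upd_eq.
- by rewrite -mx; apply: leq_trans bv _; rewrite leq_exp2l //; lia.
- exact: frame_updt.
Qed.

(** [wrd 0] holds the number of jobs and [var l] the counter, so the value is the number of
    remaining rounds, as [exec_while] requires. *)
Definition loop_cond l := Sub (Cell (Cst (wrd 0))) (Cell (Cst (var l))).

Lemma loop_condE al g m l W i : small wd rho W g -> stored wd rho al g m ->
  m (var l) = i -> i <= njob (wd g) ->
  eval m (loop_cond l) = njob (wd g) - i /\
  ecost m (loop_cond l) <= 8 * W ^ (var l + 2).
Proof.
move=> [W2 nW wW _] [mw _] mi le_i.
rewrite /= -/(wrd 0) mw mi; split=> //.
have b0 : bitlen (wrd 0) <= W ^ (var l + 2) by apply: bitlen_expn; rewrite // /wrd; lia.
have bl : bitlen (var l) <= W ^ (var l + 2) by apply: bitlen_expn => //; lia.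
have WW : W <= W ^ (var l + 2) by rewrite -{1}(expn1 W) leq_exp2l //; lia.
have bi : bitlen i <= W by apply: bitlen_leq; lia.
have := wW 0; lia.
Qed.

(* The running value after i steps has at most i * (1 + bitlen cap) more bits
   than the initial one, which is why [cap] only enters the time bound. *)
Lemma polyfun_fold e0 cap body :
  polyfun wd rho e0 -> polyfun (xwd wd) (xrho rho) cap ->
  polyfun (xwd (xwd wd)) (xrho (xrho rho)) body ->
  (forall g i a, body (g, i, a) <= a.+1 * cap (g, i)) ->
  polyfun wd rho
    (fun g => iteri (njob (wd g)) (fun i a => body (g, i, a)) (e0 g)).
Proof.
move=> p0 pcap pb le_cap l al d sz.
have sz1 : all (ltn^~ l.+1) (l :: al).
  by rewrite /= ltnSn; apply: sub_all sz => a /= /ltnW.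
have sz2 : all (ltn^~ l.+2) [:: l.+1, l & al].
  by rewrite /= ltnSn ltnS leqnSn; apply: sub_all sz => a /=; lia.
have [c0 [k0 H0]] := p0 l al d sz.
have [cc [kc Hc]] := pcap l.+1 (l :: al) d sz1.
have [cb [kb Hb]] := pb l.+2 [:: l.+1, l & al] d.+1 sz2.
(* [W ^ q] will bound the bit lengths of all running values. The body is therefore run with size
   [W ^ q] in place of [W], which costs [W ^ (q * kb)] and explains the first term of [K]. *)
pose q := k0 + kc + 4.
pose K := q * kb + q + tmp d.+1 + var l.+1 + 2.
(* The running value lives in [tmp d] and is copied to [var l.+1], where the body reads it as a
   variable; [var l] is the counter. *)
pose body_code := Seq (Store (Cst (var l.+1)) (Cell (Cst (tmp d))))
  (Seq cb (Seq (Store (Cst (tmp d)) (Cell (Cst (tmp d.+1))))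
               (Store (Cst (var l)) (Add (Cell (Cst (var l))) (Cst 1))))).
exists (Seq c0 (Seq (Store (Cst (var l)) (Cst 0)) (While (loop_cond l) body_code))).
exists (K + 8).
move=> g W m i o sm st; have [W2 nW wW vW] := sm.
pose acc j := iteri j (fun i a => body (g, i, a)) (e0 g).
have powW a b : a <= b -> W ^ a <= W ^ b by move=> le_ab; rewrite leq_exp2l.
have [m1 [t1 [E1 le1 v1 b1 fr1]]] := H0 g W m i o sm st.
have st1 := frame_stored sz fr1 st.
have smx j : j <= njob (wd g) -> small (xwd wd) (xrho rho) W (g, j).
  by move=> le_j; apply/small_x; split=> //; apply: bitlen_leq; lia.
(* The code for [cap] is not part of the program. It is applied to a hypothetical memory, only to
   learn that the value of [cap] has few bits. *)
have bcap j : j <= njob (wd g) -> bitlen (cap (g, j)) <= W ^ kc.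
  move=> /smx smj.
  have stj : stored (xwd wd) (xrho rho) (l :: al) (g, j) (upd m (var l) j).
    apply/stored_x; split; last by rewrite upd_eq.
    exact: frame_stored (frame_updv 0 _ _ (leqnn l)) st.
  by have [? [? [_ _ _ ? _]]] := Hc _ _ _ i o smj stj.
have bacc j : j <= njob (wd g) -> bitlen (acc j) <= W ^ k0 + j * (W ^ kc).+1.
  elim: j => [_|j IH lt_j]; first by rewrite addn0.
  have := leq_bitlen (le_cap g j (acc j)); rewrite -[body _]/(acc j.+1).
  have := bitlenM (acc j).+1 (cap (g, j)); have := bitlenS (acc j).
  have := bcap j (ltnW lt_j); have := IH (ltnW lt_j); rewrite mulSn; lia.
have bq j : j <= njob (wd g) -> bitlen (acc j) <= W ^ q.
  move=> le_j; apply: leq_trans (bacc j le_j) _.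
  have h0 : W ^ k0 <= W ^ (k0 + kc + 1) by apply: powW; lia.
  have h1 : j * W ^ kc <= W ^ (k0 + kc + 1).
    rewrite (leq_trans (leq_mul (leq_trans le_j nW) (leqnn _))) // -expnS.
    by apply: powW; lia.
  have h2 : j <= W ^ (k0 + kc + 1).
    rewrite (leq_trans le_j) // (leq_trans nW) // -{1}(expn1 W).
    by apply: powW; lia.
  have := @leq_mul_expn W 3 3 (k0 + kc + 1) W2 isT.
  rewrite -[k0 + kc + 1 + 3]addnA -/q mulnS; lia.
have Wq : W <= W ^ q by rewrite -{1}(expn1 W); apply: powW; rewrite /q; lia.
have smb j : j <= njob (wd g) ->
    small (xwd (xwd wd)) (xrho (xrho rho)) (W ^ q) (g, j, acc j).
  move=> le_j; apply/small_x; split; last exact: bq.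
  exact: small_leq Wq (smx j le_j).
have LK a : a <= K -> bitlen a <= W ^ K by apply: bitlen_expn.
have bvl1 : bitlen (var l.+1) <= W ^ K by apply: LK; rewrite /K; lia.
have bvl : bitlen (var l) <= W ^ K by apply: LK; rewrite /K /var; lia.
have btd1 : bitlen (tmp d.+1) <= W ^ K by apply: LK; rewrite /K; lia.
have btd : bitlen (tmp d) <= W ^ K by apply: LK; rewrite /K /tmp; lia.
have bc0 : bitlen 0 <= W ^ K by apply: LK.
have bc1 : bitlen 1 <= W ^ K by apply: LK; rewrite /K; lia.
have qK : W ^ q <= W ^ K by apply: powW; rewrite /K; lia.
have WK : W <= W ^ K by apply: leq_trans qK.
pose Inv j s := [/\ inp s = i, out s = o, frame l d m1 (mem s),
                    mem s (var l) = j & mem s (tmp d) = acc j].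
have [t2 E2 le2] := @exec_store m1 i o (Cst (var l)) (Cst 0) _ bvl bc0.
set m2 := upd _ _ _ in E2.
have inv0 : Inv 0 (State m2 i o).
  split; [by [] | by [] | exact: frame_updv | by rewrite /= /m2 upd_eq |].
  by rewrite /= /m2 upd_neq //; apply/eqP; rewrite /= /tmp /var; lia.
have loop_step j s : j < njob (wd g) -> Inv j s ->
    exists s' t, [/\ exec body_code s s' t, t <= 24 * W ^ K & Inv j.+1 s'].
  case: s => m3 _ _ lt_j [/= -> -> fr3 mj ma].
  have st3 := frame_stored sz fr3 st1.
  have ba : bitlen (m3 (tmp d)) <= W ^ K by rewrite ma (leq_trans (bq j _)) // ltnW.
  have [t4 E4 le4] := @exec_store m3 i o (Cst (var l.+1)) (Cell (Cst (tmp d))) _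
     bvl1 (introT andP (conj btd ba)).
  rewrite [eval _ _]/= [X in upd _ _ X]/= ma in E4; set m4 := upd _ _ _ in E4.
  have fr4 : frame l.+1 d.+1 m3 m4 by apply: frame_updv.
  have st4 : stored (xwd (xwd wd)) (xrho (xrho rho)) [:: l.+1, l & al]
                    (g, j, acc j) m4.
    apply/stored_x; split; last by rewrite /m4 upd_eq.
    apply: frame_stored sz1 fr4 _.
    by apply/stored_x.
  have [m5 [t5 [E5 le5 v5 b5 fr5]]] := Hb _ _ _ i o (smb j (ltnW lt_j)) st4.
  rewrite -[body _]/(acc j.+1) in v5.
  have b5' : bitlen (m5 (tmp d.+1)) <= W ^ K by rewrite v5 (leq_trans (bq _ _)).
  have [t6 E6 le6] := @exec_store m5 i o (Cst (tmp d)) (Cell (Cst (tmp d.+1))) _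
     btd (introT andP (conj btd1 b5')).
  rewrite [eval _ _]/= [X in upd _ _ X]/= v5 in E6; set m6 := upd _ _ _ in E6.
  have m6j : m6 (var l) = j.
    rewrite /m6 upd_neq; last by apply/eqP; rewrite /= /tmp /var; lia.
    have [_ -> // _] := fr5 l; rewrite /m4 upd_neq //.
    by apply/eqP; rewrite /= /var; lia.
  have bj : bitlen j <= W ^ K by apply: bitlen_leq; lia.
  have be : ebounded m6 (W ^ K) (Add (Cell (Cst (var l))) (Cst 1)).
    by rewrite /= bvl bc1 m6j bj.
  have [t7 E7 le7] := @exec_store m6 i o (Cst (var l)) _ _ bvl be.
  rewrite [eval _ _]/= [X in upd _ _ X]/= m6j addn1 in E7.
  set m7 := upd _ _ _ in E7.
  exists (State m7 i o), (t4 + (t5 + (t6 + t7))); split.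
  - exact: ExecSeq E4 (ExecSeq E5 (ExecSeq E6 E7)).
  - have: t5 <= W ^ K.
      by apply: leq_trans le5 _; rewrite -expnM; apply: powW; rewrite /K; lia.
    rewrite /= in le4 le6 le7; lia.
  - split=> //=.
    + apply: frame_trans fr3 _.
      apply: (@frame_trans _ _ _ m4); first by apply: frame_sub fr4; lia.
      apply: (@frame_trans _ _ _ m5); first by apply: frame_sub fr5; lia.
      exact: frame_trans (frame_updt _ _ _ (leqnn d)) (frame_updv _ _ _ (leqnn l)).
    + by rewrite /m7 upd_eq.
    + rewrite /m7 upd_neq; last by apply/eqP; rewrite /= /tmp /var; lia.
      by rewrite /m6 upd_eq.
have loop_test j s : j <= njob (wd g) -> Inv j s ->
    eval (mem s) (loop_cond l) = njob (wd g) - j /\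
    ecost (mem s) (loop_cond l) <= 8 * W ^ K.
  case: s => m3 _ _ le_j [/= _ _ fr3 mj ma].
  have [ev le_c] := loop_condE sm (frame_stored sz fr3 st1) mj le_j; split=> //.
  apply: leq_trans le_c _; rewrite leq_mul2l /=; apply: powW.
  by rewrite /K /var; lia.
have [[m3 i3 o3] [t3 [E3 le3 [/= ei eo fr3 _ ma]]]] := exec_while loop_test loop_step inv0.
rewrite {}ei {}eo in E3.
exists m3, (t1 + (t2 + t3)); split=> //.
- exact: ExecSeq E1 (ExecSeq E2 E3).
- have h1 : W ^ k0 <= W ^ K by apply: powW; rewrite /K /q; lia.
  have h2 : W ^ K <= W ^ K.+1 by apply: powW.
  have h3 : njob (wd g) * (8 * W ^ K + 24 * W ^ K) <= 32 * W ^ K.+1.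
    by rewrite -mulnDl mulnCA leq_mul2l expnS leq_mul2r nW orbT.
  have h4 := @leq_mul_expn W 45 6 K.+1 W2 isT.
  apply: (@leq_trans (W ^ (K.+1 + 6))); last by apply: powW; lia.
  by rewrite /= in le2; lia.
- by apply: leq_trans (bq _ (leqnn _)) _; apply: powW; rewrite /K; lia.
- exact: frame_trans fr1 fr3.
Qed.

End Variables.

(** * Comparisons, conditionals and maxima expressed by arithmetic *)

Section Derived.
Variables (G : Type) (wd : G -> seq nat) (rho : seq (G -> nat)).
Local Notation pfun := (polyfun wd rho).

Lemma polyfun_njob : pfun (fun g => njob (wd g)).
Proof. exact: polyfun_word (polyfun_const _ _ 0). Qed.

Lemma polyfun_succ f : pfun f -> pfun (fun g => (f g).+1).
Proof.
move=> pf; apply: polyfun_ext (polyfun_add pf (polyfun_const _ _ 1)) _ => g.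
by rewrite addn1.
Qed.

Lemma polyfun_leq f1 f2 : pfun f1 -> pfun f2 -> pfun (fun g => f1 g <= f2 g).
Proof.
move=> p1 p2; apply: polyfun_ext (polyfun_sub (polyfun_const _ _ 1) (polyfun_sub p1 p2)) _.
by move=> g; case: leqP; lia.
Qed.

Lemma polyfun_ltn f1 f2 : pfun f1 -> pfun f2 -> pfun (fun g => f1 g < f2 g).
Proof. by move=> p1 p2; apply: polyfun_leq p2; apply: polyfun_succ. Qed.

Lemma polyfun_and (b1 b2 : G -> bool) : pfun b1 -> pfun b2 ->
  pfun (fun g => b1 g && b2 g).
Proof.
by move=> p1 p2; apply: polyfun_ext (polyfun_mul p1 p2) _ => g; rewrite mulnb.
Qed.

(** Both branches are evaluated, and multiplication by the truth value selects one of them; no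
    control flow is needed. *)
Lemma polyfun_if (b : G -> bool) f1 f2 : pfun b -> pfun f1 -> pfun f2 ->
  pfun (fun g => if b g then f1 g else f2 g).
Proof.
move=> pb p1 p2.
apply: polyfun_ext (polyfun_add (polyfun_mul pb p1)
  (polyfun_mul (polyfun_sub (polyfun_const _ _ 1) pb) p2)) _ => g.
by case: (b g); rewrite ?mul0n ?mul1n ?addn0.
Qed.

Lemma polyfun_maxn f1 f2 : pfun f1 -> pfun f2 -> pfun (fun g => maxn (f1 g) (f2 g)).
Proof.
move=> p1 p2; apply: polyfun_ext (polyfun_add p1 (polyfun_sub p2 p1)) _ => g.
by rewrite maxnE.
Qed.

End Derived.

Section Big.
Variables (G : Type) (wd : G -> seq nat) (rho : seq (G -> nat)).
Local Notation pfun := (polyfun wd rho).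
Local Notation pfunx := (polyfun (xwd wd) (xrho rho)).

(** Since [a + f <= a.+1 * f.+1], the factor [f.+1] is admissible in [polyfun_fold]. *)
Lemma polyfun_sum f : pfunx f ->
  pfun (fun g => \sum_(i < njob (wd g)) f (g, nat_of_ord i)).
Proof.
move=> pf; apply: polyfun_ext (polyfun_fold (polyfun_const wd rho 0) (polyfun_succ pf)
   (polyfun_add (polyfun_idx _ _) (polyfun_weak pf)) _) _ => [g i a | g] /=; first nia.
elim: (njob _) => [|n IH]; first by rewrite big_ord0.
by rewrite /= IH big_ord_recr.
Qed.

Lemma polyfun_prod f : pfunx f ->
  pfun (fun g => \prod_(i < njob (wd g)) f (g, nat_of_ord i)).
Proof.
move=> pf; apply: polyfun_ext (polyfun_fold (polyfun_const wd rho 1) pf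
   (polyfun_mul (polyfun_idx _ _) (polyfun_weak pf)) _) _ => [g i a | g] /=; first nia.
elim: (njob _) => [|n IH]; first by rewrite big_ord0.
by rewrite /= IH big_ord_recr.
Qed.

Lemma polyfun_bigmax f : pfunx f ->
  pfun (fun g => \max_(i < njob (wd g)) f (g, nat_of_ord i)).
Proof.
move=> pf; apply: polyfun_ext (polyfun_fold (polyfun_const wd rho 0) (polyfun_succ pf)
   (polyfun_maxn (polyfun_idx _ _) (polyfun_weak pf)) _) _ => [g i a | g] /=; first nia.
elim: (njob _) => [|n IH]; first by rewrite big_ord0.
by rewrite /= IH big_ord_recr.
Qed.

(** A step never increases the running value, so the constant factor 1 is admissible. *)
Lemma polyfun_bigmin e (b : G * nat -> bool) f : pfun e -> pfunx b -> pfunx f ->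
  pfun (fun g => iteri (njob (wd g))
    (fun i a => if b (g, i) && (f (g, i) < a) then f (g, i) else a) (e g)).
Proof.
move=> pe pb pf; apply: (polyfun_fold (cap := fun=> 1)
  (body := fun g => if b g.1 && (f g.1 < g.2) then f g.1 else g.2)) pe _ _ _.
- exact: polyfun_const.
- have pfw := polyfun_weak pf; have pi := polyfun_idx (xwd wd) (xrho rho).
  exact: polyfun_if (polyfun_and (polyfun_weak pb) (polyfun_ltn pfw pi)) pfw pi.
- by move=> g i a /=; case: ifP; lia.
Qed.

End Big.

(** * Programs that write output *)

Section Output.
Variables (G : Type) (wd : G -> seq nat) (rho : seq (G -> nat)).
Local Notation pout := (polyout wd rho).

Lemma polyout_write f : polyfun wd rho f -> pout (fun g => [:: f g]).
Proof.
move=> pf l al sz; have [c [k H]] := pf l al 0 sz.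
exists (Seq c (Write (Cell (Cst 0)))), (k + 3) => g W m i o sm st.
have [m1 [t1 [E1 le1 v1 b1 fr1]]] := H g W m i o sm st.
have [W2 _ _ _] := sm; rewrite -[tmp 0]/0 in v1.
have W1 : 0 < W ^ k by rewrite expn_gt0 ltnW.
exists m1, (t1 + (bitlen 0 + bitlen 0 + bitlen (f g) + bitlen (f g))); split=> //.
- apply: ExecSeq E1 _; rewrite cats1 -v1.
  exact: (ExecWrite (Cell (Cst 0)) (State m1 i o)).
- have := @leq_mul_expn W 5 3 k W2 isT; have: bitlen 0 = 1 by [].
  by lia.
Qed.

Lemma polyout_cat f1 f2 : pout f1 -> pout f2 -> pout (fun g => f1 g ++ f2 g).
Proof.
move=> p1 p2 l al sz; have [c1 [k1 H1]] := p1 l al sz; have [c2 [k2 H2]] := p2 l al sz.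
exists (Seq c1 c2), (k1 + k2 + 1) => g W m i o sm st.
have [m1 [t1 [E1 le1 fr1]]] := H1 g W m i o sm st.
have st1 := frame_stored sz fr1 st.
have [m2 [t2 [E2 le2 fr2]]] := H2 g W m1 i (o ++ f1 g) sm st1.
have [W2 _ _ _] := sm.
exists m2, (t1 + t2); split; last exact: frame_trans fr2.
  by rewrite catA; apply: ExecSeq E1 E2.
have := @leq_mul_expn W 2 1 (k1 + k2) W2 isT.
have: W ^ k1 <= W ^ (k1 + k2) by rewrite leq_exp2l //; lia.
have: W ^ k2 <= W ^ (k1 + k2) by rewrite leq_exp2l //; lia.
lia.
Qed.

Lemma polyout_when (b : G -> bool) f : polyfun wd rho b -> pout f ->
  pout (fun g => if b g then f g else [::]).
Proof.
move=> pb pf l al sz; have [c1 [k1 H1]] := pb l al 0 sz; have [c2 [k2 H2]] := pf l al sz.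
exists (Seq c1 (If (Cell (Cst 0)) c2 Skip)), (k1 + k2 + 3) => g W m i o sm st.
have [m1 [t1 [E1 le1 v1 b1 fr1]]] := H1 g W m i o sm st.
have st1 := frame_stored sz fr1 st.
have [m2 [t2 [E2 le2 fr2]]] := H2 g W m1 i o sm st1.
have [W2 _ _ _] := sm; rewrite -[tmp 0]/0 in v1.
have W1 : 0 < W ^ (k1 + k2) by rewrite expn_gt0 ltnW.
have h := @leq_mul_expn W 6 3 (k1 + k2) W2 isT.
have h1 : W ^ k1 <= W ^ (k1 + k2) by rewrite leq_exp2l //; lia.
have h2 : W ^ k2 <= W ^ (k1 + k2) by rewrite leq_exp2l //; lia.
have c0 : ecost m1 (Cell (Cst 0)) = 3 by rewrite /= v1; case: (b g).
case bg: (b g); rewrite bg /= in v1.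
- exists m2, (t1 + (ecost m1 (Cell (Cst 0)) + t2)); split; last exact: frame_trans fr2.
    by apply: ExecSeq E1 _; apply: ExecIfT E2; rewrite /= v1.
  by rewrite c0; lia.
- exists m1, (t1 + (ecost m1 (Cell (Cst 0)) + 1)); rewrite cats0; split=> //.
    by apply: ExecSeq E1 _; apply: ExecIfF (ExecSkip _); rewrite /= v1.
  by rewrite c0; lia.
Qed.

Lemma polyout_for f : polyout (xwd wd) (xrho rho) f ->
  pout (fun g => flatten [seq f (g, i) | i <- iota 0 (njob (wd g))]).
Proof.
move=> pf l al sz.
have sz1 : all (ltn^~ l.+1) (l :: al).
  by rewrite /= ltnSn; apply: sub_all sz => a /= /ltnW.
have [c [k H]] := pf l.+1 (l :: al) sz1.
pose K := k + var l + 2.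
pose body := Seq c (Store (Cst (var l)) (Add (Cell (Cst (var l))) (Cst 1))).
exists (Seq (Store (Cst (var l)) (Cst 0)) (While (loop_cond l) body)), (K + 7).
move=> g W m i o sm st; have [W2 nW wW vW] := sm.
have powW a b : a <= b -> W ^ a <= W ^ b by move=> le_ab; rewrite leq_exp2l.
have LK a : a <= K -> bitlen a <= W ^ K by apply: bitlen_expn.
have bvl : bitlen (var l) <= W ^ K by apply: LK; rewrite /K; lia.
have bc0 : bitlen 0 <= W ^ K by apply: LK.
have bc1 : bitlen 1 <= W ^ K by apply: LK; rewrite /K; lia.
have WK : W <= W ^ K by rewrite -{1}(expn1 W); apply: powW; rewrite /K; lia.
pose pre j := flatten [seq f (g, i) | i <- iota 0 j].
pose Inv j s := [/\ inp s = i, out s = o ++ pre j, frame l 0 m (mem s)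
                  & mem s (var l) = j].
have [t1 E1 le1] := @exec_store m i o (Cst (var l)) (Cst 0) _ bvl bc0.
set m1 := upd _ _ _ in E1.
have inv0 : Inv 0 (State m1 i o).
  split; [by [] | by rewrite /pre /= cats0 | exact: frame_updv | by rewrite /= /m1 upd_eq].
have loop_step j s : j < njob (wd g) -> Inv j s ->
    exists s' t, [/\ exec body s s' t, t <= 11 * W ^ K & Inv j.+1 s'].
  case: s => m3 _ _ lt_j [/= -> -> fr3 mj].
  have bj : bitlen j <= W by apply: bitlen_leq; lia.
  have st3 := frame_stored sz fr3 st.
  have smj : small (xwd wd) (xrho rho) W (g, j) by apply/small_x.
  have stj : stored (xwd wd) (xrho rho) (l :: al) (g, j) m3 by apply/stored_x.
  have [m4 [t4 [E4 le4 fr4]]] := H _ _ _ i (o ++ pre j) smj stj.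
  have m4j : m4 (var l) = j by have [_ fv _] := fr4 l; rewrite fv.
  have be : ebounded m4 (W ^ K) (Add (Cell (Cst (var l))) (Cst 1)).
    by rewrite /= bvl bc1 m4j (leq_trans bj).
  have [t7 E7 le7] := @exec_store m4 i ((o ++ pre j) ++ f (g, j)) (Cst (var l)) _ _ bvl be.
  rewrite [eval _ _]/= [X in upd _ _ X]/= m4j addn1 in E7.
  set m7 := upd _ _ _ in E7.
  exists (State m7 i ((o ++ pre j) ++ f (g, j))), (t4 + t7); split.
  - exact: ExecSeq E4 E7.
  - have: W ^ k <= W ^ K by apply: powW; rewrite /K; lia.
    by rewrite /= in le7; lia.
  - split=> //=.
    + by rewrite -catA /pre -addn1 iotaD map_cat flatten_cat /= cats0.
    + apply: frame_trans fr3 (frame_trans _ (frame_updv _ _ _ (leqnn l))).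
      by apply: frame_sub fr4; lia.
    + by rewrite /m7 upd_eq.
have loop_test j s : j <= njob (wd g) -> Inv j s ->
    eval (mem s) (loop_cond l) = njob (wd g) - j /\
    ecost (mem s) (loop_cond l) <= 8 * W ^ K.
  case: s => m3 _ _ le_j [/= _ _ fr3 mj].
  have [ev le_c] := loop_condE sm (frame_stored sz fr3 st) mj le_j; split=> //.
  apply: leq_trans le_c _; rewrite leq_mul2l /=; apply: powW.
  by rewrite /K; lia.
have [[m3 i3 o3] [t3 [E3 le3 [/= ei eo fr3 _]]]] := exec_while loop_test loop_step inv0.
rewrite {}ei {}eo in E3.
exists m3, (t1 + t3); split=> //; first exact: ExecSeq E1 E3.
have h2 : W ^ K <= W ^ K.+1 by apply: powW.
have h3 : njob (wd g) * (8 * W ^ K + 11 * W ^ K) <= 19 * W ^ K.+1.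
  by rewrite -mulnDl mulnCA leq_mul2l expnS leq_mul2r nW orbT.
have h4 := @leq_mul_expn W 31 6 K.+1 W2 isT.
apply: (@leq_trans (W ^ (K.+1 + 6))); last by apply: powW; lia.
by rewrite /= in le1; lia.
Qed.

End Output.

(** * Loading the input and running from the initial state *)

Lemma size_wordlen w : size w <= wordlen w.
Proof.
elim: w => //= x w IH; rewrite /wordlen /= -/(wordlen w).
by have := bitlen_gt0 x; lia.
Qed.

Lemma bitlen_nth w i : 0 < size w -> bitlen (nth 0 w i) <= wordlen w.
Proof.
move=> w_gt0; have [lt_i|ge_i] := ltnP i (size w); last first.
  by rewrite nth_default // (leq_trans _ (size_wordlen w)).
elim: w i lt_i {w_gt0} => [|x w IH] [|i] //=; rewrite /wordlen /= -/(wordlen w).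
  by rewrite leq_addr.
by rewrite ltnS => /IH/leq_trans; apply; rewrite leq_addl.
Qed.

Section Run.
Variable f : seq nat -> seq nat.
Hypothesis pf : polyout id [::] f.

(** An encoded instance with n jobs has 4n + 5 words: n itself, then numerator and denominator of 2
    + 2n numbers. The word n is read first, into cell 2, which is [wrd 0]; cell 0 is the counter j.
    The test is the number of words still to be read, and the next one goes to cell 3j + 5, which is
    [wrd j.+1]. *)
Definition read_cond := Sub (Add (Mul (Cst 4) (Cell (Cst 2))) (Cst 4)) (Cell (Cst 0)).
Definition read_body :=
  Seq (Read (Add (Mul (Cst 3) (Cell (Cst 0))) (Cst 5)))
      (Store (Cst 0) (Add (Cell (Cst 0)) (Cst 1))).

Lemma polyout_run : exists c k, forall w, size w = 4 * njob w + 5 ->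
  exists s t, [/\ exec c (init w) s t, t <= k * wordlen w ^ k + k & out s = f w].
Proof.
have [c [k H]] := @pf 0 [::] isT.
exists (Seq (Seq (Read (Cst 2)) (While read_cond read_body)) c), (k + 20).
move=> w sw; set n := njob w in sw.
set W := wordlen w.
have szW : size w <= W by apply: size_wordlen.
have bw i : bitlen (nth 0 w i) <= W by apply: bitlen_nth; rewrite sw addn_gt0 orbT.
have b10 i : i <= 5 -> bitlen i <= W.
  by move=> le_i; apply: bitlen_leq; lia.
have [b0 b1 b2] : [/\ bitlen 0 <= W, bitlen 1 <= W & bitlen 2 <= W] by split; apply: b10.
have [b3 b4 b5] : [/\ bitlen 3 <= W, bitlen 4 <= W & bitlen 5 <= W] by split; apply: b10.
have bn : bitlen n <= W := bw 0.
pose m0 := upd (fun=> 0) 2 (head 0 w).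
have E0 : exec (Read (Cst 2)) (init w) (State m0 (behead w) [::])
   (bitlen 2 + bitlen 2 + bitlen (head 0 w)) by exact: (ExecRead (Cst 2) (init w)).
pose Inv j s := [/\ mem s 0 = j,
   forall i, mem s (wrd i) = if i <= j then nth 0 w i else 0,
   inp s = drop j.+1 w & out s = [::]].
have inv0 : Inv 0 (State m0 (behead w) [::]).
  split=> [||/=|] //; last by rewrite drop1.
  move=> i /=; rewrite /m0 /upd /wrd; case: i => [|i] /=; first by rewrite nth0.
  by case: eqP => //; lia.
have mem2 j s : Inv j s -> mem s 2 = n by case=> _ /(_ 0).
have loop_test j s : j <= 4 * n + 4 -> Inv j s ->
    eval (mem s) read_cond = 4 * n + 4 - j /\ ecost (mem s) read_cond <= 30 * W.
  move=> le_j inv; have [mj mw _ _] := inv; have m2 := mem2 _ _ inv.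
  split; first by rewrite /= m2 mj.
  have: ebounded (mem s) W read_cond.
    by rewrite /= m2 mj bn b4 b2 b0 /=; apply: bitlen_leq; lia.
  by move/ebounded_leq=> [_ /=]; lia.
have loop_step j s : j < 4 * n + 4 -> Inv j s ->
    exists s' t, [/\ exec read_body s s' t, t <= 30 * W & Inv j.+1 s'].
  case: s => m i o lt_j [/= mj mw -> ->].
  have bj : bitlen j <= W by apply: bitlen_leq; lia.
  set s := State _ _ _.
  pose m1 := upd m (wrd j.+1) (nth 0 w j.+1).
  have hd : head 0 (drop j.+1 w) = nth 0 w j.+1 by rewrite -nth0 nth_drop addn0.
  have aE : eval m (Add (Mul (Cst 3) (Cell (Cst 0))) (Cst 5)) = wrd j.+1.
    by rewrite /= mj /wrd; lia.
  have E1 := ExecRead (Add (Mul (Cst 3) (Cell (Cst 0))) (Cst 5)) s.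
  rewrite [mem s]/= [inp s]/= [out s]/= aE hd -/m1 in E1.
  have m1j : m1 0 = j by rewrite /m1 upd_neq //; apply/eqP; rewrite /wrd; lia.
  have [t2 E2 le2] := @exec_store m1 (behead (drop j.+1 w)) [::] (Cst 0)
    (Add (Cell (Cst 0)) (Cst 1)) W b0 ltac:(by rewrite /= m1j bj b0).
  rewrite [eval _ _]/= [X in upd _ _ X]/= m1j addn1 in E2.
  exists (State (upd m1 0 j.+1) (behead (drop j.+1 w)) [::]).
  eexists; split; first exact: ExecSeq E1 E2.
    have: ebounded m W (Add (Mul (Cst 3) (Cell (Cst 0))) (Cst 5)).
      by rewrite /= mj bj b0 b3 ?b5.
    move/ebounded_leq=> [va ca]; rewrite aE in va.
    by have := bw j.+1; move: va ca le2; rewrite /=; lia.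
  split=> [|i'||] //=; last 1 first.
  - by rewrite -drop1 drop_drop add1n.
  - rewrite upd_neq; last by apply/eqP; rewrite /wrd; lia.
    rewrite /m1 /upd mw; case: eqP; rewrite /wrd => h.
      have -> : i' = j.+1 by lia.
      by rewrite leqnn.
    have -> : (i' <= j.+1) = (i' <= j) by lia.
    by [].
have [[m i o] [t1 [E1 le1 [/= _ mw ei eo]]]] := exec_while loop_test loop_step inv0.
rewrite {}ei {}eo in E1.
(* Beyond the input the untouched cells hold 0, which is also the default value of [nth]. *)
have st : stored id [::] [::] w m.
  split=> // i1; rewrite mw; case: leqP => // lt_i.
  by rewrite nth_default //; lia.
have sm : small id [::] W w by split=> //; rewrite -/n; lia.
have [m2 [t2 [E2 le2 _]]] := H w W m (drop (4 * n + 4).+1 w) [::] sm st.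
exists (State m2 (drop (4 * n + 4).+1 w) (f w)).
have E := ExecSeq (ExecSeq E0 E1) E2.
eexists; split; [exact: E | | by []].
have W2 : 1 < W by lia.
apply: (@leq_trans (W ^ (k + 20))); last by rewrite -[X in X <= _]mul1n; nia.
have h1 : W ^ k <= W ^ (k + 2) by rewrite leq_exp2l //; lia.
have h2 : W * W <= W ^ (k + 2) by rewrite mulnn leq_exp2l //; lia.
have h3 : W <= W * W by rewrite leq_pmull // ltnW.
have h4 : (4 * n + 4) * (30 * W + 30 * W) <= 60 * (W * W).
  by rewrite -mulnDl mulnCA leq_mul2l leq_mul2r; apply/orP; right; lia.
have h5 := @leq_mul_expn W 94 7 (k + 2) W2 isT.
have h6 : W ^ (k + 2 + 7) <= W ^ (k + 20) by rewrite leq_exp2l //; lia.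
have := bw 0; rewrite nth0 => bh.
by lia.
Qed.

End Run.

(** * The algorithm *)

(* Numerators and denominators of the input: the numbers 0 and 1 are K0 and K1,
   followed by the processing times and the release dates. *)
Definition num w i := nth 0 w (2 * i).+1.
Definition dnm w i := nth 0 w (2 * i).+2.

(** The product of all denominators serves as common denominator: its bit length is at most the sum
    of theirs. *)
Definition scale w :=
  dnm w 0 * dnm w 1 *
  \prod_(j < njob w) (dnm w (2 + j) * dnm w (2 + njob w + j)).

Definition scaled w i := num w i * (scale w %/ dnm w i).
Definition unit_cost w := scaled w 0 + scaled w 1.
Definition ptime w j := scaled w (2 + j).
Definition rtime w j := scaled w (2 + njob w + j).

(* Orders the jobs by release date, ties being broken by the index. *)
Definition key w j := rtime w j * njob w + j.

Definition load w j k :=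
  \sum_(l < njob w)
    (if (key w j <= key w l) && (key w l <= key w k) then ptime w l else 0).

Definition rtotal w := \sum_(j < njob w) rtime w j.

(* A translate by [rtotal w], which is at least every release date, keeps the
   values natural: with maximal flow time [F], job [j] cannot start after
   [F + rtotal w - tail w j]. *)
Definition tail w j :=
  \max_(k < njob w)
    (if key w j <= key w k then load w j k + (rtotal w - rtime w k) else 0).

Definition latest w F j := F + rtotal w - tail w j.

(* The least flow time for which a replenishment at the release date of [i]
   is not too late for [k]. *)
Definition flow w k i := rtime w i + tail w k - rtotal w.
(** For F from this value on, every interval from [rtime w j] to [latest w F j] is nonempty, and the
    subtraction in [latest] is not truncated. *)
Definition flow0 w := \max_(k < njob w) flow w k k.

(** Exceeds every [(latest w F j).+1], so it can stand for the minimum of the empty set in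
    [advance]. *)
Definition horizon w F := (F + rtotal w).+2.

(** One greedy step. The unserved jobs are those released at [v] or later; the next point is the
    least of their right ends. The result is one more than this point, so that the jobs still
    unserved are again those released at or after it. *)
Definition advance w F v :=
  iteri (njob w)
    (fun j a => if (v <= rtime w j) && ((latest w F j).+1 < a)
                then (latest w F j).+1 else a) (horizon w F).

(* After [m] greedy steps the jobs released before [front w F m] are served;
   [horizon w F] signals that no job is left. *)
Definition front w F m :=
  iteri (njob w) (fun i v => if i < m then advance w F v else v) 0.

(** As many steps as there are jobs suffice, because each one serves a further job; steps at the
    horizon found no job left and place no point. *)
Definition nrepl w F := \sum_(m < njob w) (front w F m.+1 < horizon w F).
Definition price w F := F + nrepl w F * unit_cost w.

(** Thresholds below [flow0 w] are raised to it, where the greedy analysis is valid. *)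
Definition cand w k i := maxn (flow0 w) (flow w k i).

Definition argbest w (f : nat -> nat) :=
  iteri (njob w) (fun i a => if price w (f i) < price w a then f i else a)
    (flow0 w).

(** The search over pairs of jobs is split into two nested searches, each a loop over the jobs. *)
Definition best w := argbest w (fun k => argbest w (cand w k)).

Definition solution_word w :=
  nrepl w (best w) ::
  flatten [seq [:: latest w (best w) j; scale w] | j <- iota 0 (njob w)] ++
  flatten [seq if front w (best w) m.+1 < horizon w (best w)
               then [:: front w (best w) m.+1 - 1; scale w] else [::]
          | m <- iota 0 (njob w)].

(** * The quantities of the algorithm are computable in polynomial time *)

Section Functions.
Variables (G : Type) (wd : G -> seq nat) (rho : seq (G -> nat)).
Local Notation pfun := (polyfun wd rho).

Lemma polyfun_num f : pfun f -> pfun (fun g => num (wd g) (f g)).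
Proof.
by move=> pf; apply/polyfun_word/polyfun_succ/polyfun_mul => //; apply: polyfun_const.
Qed.

Lemma polyfun_dnm f : pfun f -> pfun (fun g => dnm (wd g) (f g)).
Proof.
move=> pf; apply/polyfun_word/polyfun_succ/polyfun_succ/polyfun_mul => //.
exact: polyfun_const.
Qed.
End Functions.

Lemma polyfun_scale G wd (rho : seq (G -> nat)) :
  polyfun wd rho (fun g => scale (wd g)).
Proof.
have pc v : polyfun wd rho (fun=> v) by apply: polyfun_const.
apply: polyfun_mul; first exact: polyfun_mul (polyfun_dnm (pc 0)) (polyfun_dnm (pc 1)).
apply: (polyfun_prod (f := fun g => dnm (xwd wd g) (2 + g.2) *
  dnm (xwd wd g) (2 + njob (xwd wd g) + g.2))).
have pc2 : polyfun (xwd wd) (xrho rho) (fun=> 2) by apply: polyfun_const.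
have pi := polyfun_idx wd rho.
apply: polyfun_mul; apply: polyfun_dnm; first exact: polyfun_add.
exact: polyfun_add (polyfun_add pc2 (polyfun_njob _ _)) pi.
Qed.

Section Times.
Variables (G : Type) (wd : G -> seq nat) (rho : seq (G -> nat)).
Local Notation pfun := (polyfun wd rho).

Lemma polyfun_scaled f : pfun f -> pfun (fun g => scaled (wd g) (f g)).
Proof.
move=> pf; have pd := polyfun_dnm pf.
exact: polyfun_mul (polyfun_num pf) (polyfun_div (polyfun_scale _ _) pd).
Qed.

Lemma polyfun_unit_cost : pfun (fun g => unit_cost (wd g)).
Proof. by apply: polyfun_add; apply: polyfun_scaled; apply: polyfun_const. Qed.

Lemma polyfun_ptime f : pfun f -> pfun (fun g => ptime (wd g) (f g)).
Proof. by move=> pf; apply/polyfun_scaled/polyfun_add => //; apply: polyfun_const. Qed.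

Lemma polyfun_rtime f : pfun f -> pfun (fun g => rtime (wd g) (f g)).
Proof.
move=> pf; apply/polyfun_scaled/polyfun_add => //; apply: polyfun_add.
  exact: polyfun_const.
exact: polyfun_njob.
Qed.

Lemma polyfun_key f : pfun f -> pfun (fun g => key (wd g) (f g)).
Proof.
move=> pf; exact: polyfun_add (polyfun_mul (polyfun_rtime pf) (polyfun_njob _ _)) pf.
Qed.
End Times.

Section Load.
Variables (G : Type) (wd : G -> seq nat) (rho : seq (G -> nat)).
Local Notation pfun := (polyfun wd rho).

Lemma polyfun_load j k : pfun j -> pfun k ->
  pfun (fun g => load (wd g) (j g) (k g)).
Proof.
move=> /polyfun_weak/polyfun_key pj /polyfun_weak/polyfun_key pk.
have pi := polyfun_idx wd rho; have pki := polyfun_key pi.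
exact: polyfun_sum (polyfun_if (polyfun_and (polyfun_leq pj pki) (polyfun_leq pki pk))
  (polyfun_ptime pi) (polyfun_const _ _ 0)).
Qed.

Lemma polyfun_rtotal : pfun (fun g => rtotal (wd g)).
Proof. exact: polyfun_sum (polyfun_rtime (polyfun_idx wd rho)). Qed.
End Load.

Section Greedy.
Variables (G : Type) (wd : G -> seq nat) (rho : seq (G -> nat)).
Local Notation pfun := (polyfun wd rho).

Lemma polyfun_tail j : pfun j -> pfun (fun g => tail (wd g) (j g)).
Proof.
move=> /polyfun_weak pj; have pi := polyfun_idx wd rho.
exact: polyfun_bigmax (polyfun_if (polyfun_leq (polyfun_key pj) (polyfun_key pi))
  (polyfun_add (polyfun_load pj pi) (polyfun_sub (polyfun_rtotal _ _) (polyfun_rtime pi)))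
  (polyfun_const _ _ 0)).
Qed.

Lemma polyfun_latest F j : pfun F -> pfun j ->
  pfun (fun g => latest (wd g) (F g) (j g)).
Proof.
move=> pF pj.
exact: polyfun_sub (polyfun_add pF (polyfun_rtotal _ _)) (polyfun_tail pj).
Qed.

Lemma polyfun_flow k i : pfun k -> pfun i ->
  pfun (fun g => flow (wd g) (k g) (i g)).
Proof.
move=> pk pi; apply: polyfun_sub (polyfun_rtotal _ _).
exact: polyfun_add (polyfun_rtime pi) (polyfun_tail pk).
Qed.

Lemma polyfun_horizon F : pfun F -> pfun (fun g => horizon (wd g) (F g)).
Proof. by move=> pF; apply/polyfun_succ/polyfun_succ/polyfun_add/polyfun_rtotal. Qed.
End Greedy.

Section Front.
Variables (G : Type) (wd : G -> seq nat) (rho : seq (G -> nat)).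
Local Notation pfun := (polyfun wd rho).

Lemma polyfun_flow0 : pfun (fun g => flow0 (wd g)).
Proof. by have pi := polyfun_idx wd rho; exact: polyfun_bigmax (polyfun_flow pi pi). Qed.

Lemma polyfun_advance F v : pfun F -> pfun v ->
  pfun (fun g => advance (wd g) (F g) (v g)).
Proof.
move=> pF pv; have pi := polyfun_idx wd rho.
exact: polyfun_bigmin (polyfun_horizon pF)
  (polyfun_leq (polyfun_weak pv) (polyfun_rtime pi))
  (polyfun_succ (polyfun_latest (polyfun_weak pF) pi)).
Qed.
End Front.

(** The minimum starts from the horizon and only decreases. This bounds the growth in the loop that
    computes [front]. *)
Lemma advance_horizon w F v : advance w F v <= horizon w F.
Proof. by rewrite /advance; elim: (njob w) => //= n IH; case: ifP => //; lia. Qed.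

Section Price.
Variables (G : Type) (wd : G -> seq nat) (rho : seq (G -> nat)).
Local Notation pfun := (polyfun wd rho).

Lemma polyfun_front F m : pfun F -> pfun m ->
  pfun (fun g => front (wd g) (F g) (m g)).
Proof.
move=> pF pm; have pi := polyfun_idx wd rho.
have pv := polyfun_idx (xwd wd) (xrho rho).
have pn := polyfun_advance (polyfun_weak (polyfun_weak pF)) pv.
have pl := polyfun_ltn (polyfun_weak pi) (polyfun_weak (polyfun_weak pm)).
apply: (polyfun_fold (polyfun_const wd rho 0)
  (polyfun_succ (polyfun_horizon (polyfun_weak pF))) (polyfun_if pl pn pv)).
move=> g i a /=; case: ifP => _; last nia.
rewrite /xwd /= (leq_trans (advance_horizon _ _ _)) //; nia.
Qed.
End Price.

Section Best.
Variables (G : Type) (wd : G -> seq nat) (rho : seq (G -> nat)).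
Local Notation pfun := (polyfun wd rho).

Lemma polyfun_nrepl F : pfun F -> pfun (fun g => nrepl (wd g) (F g)).
Proof.
move=> /polyfun_weak pF; have pi := polyfun_idx wd rho.
exact: polyfun_sum (polyfun_ltn (polyfun_front pF (polyfun_succ pi)) (polyfun_horizon pF)).
Qed.

Lemma polyfun_price F : pfun F -> pfun (fun g => price (wd g) (F g)).
Proof.
move=> pF; have pn := polyfun_nrepl pF.
exact: polyfun_add pF (polyfun_mul pn (polyfun_unit_cost _ _)).
Qed.

Lemma polyfun_cand k i : pfun k -> pfun i ->
  pfun (fun g => cand (wd g) (k g) (i g)).
Proof. by move=> pk pi; apply: polyfun_maxn (polyfun_flow0 _ _) (polyfun_flow pk pi). Qed.
End Best.

Lemma polyfun_argbest G wd (rho : seq (G -> nat)) f :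
  polyfun (xwd wd) (xrho rho) f ->
  polyfun wd rho (fun g => argbest (wd g) (fun i => f (g, i))).
Proof.
move=> pf; have pv := polyfun_idx (xwd wd) (xrho rho).
have pfw := polyfun_weak pf.
apply: (polyfun_fold (polyfun_flow0 wd rho) (polyfun_succ pf)
  (polyfun_if (polyfun_ltn (polyfun_price pfw) (polyfun_price pv)) pfw pv)).
by move=> g i a /=; case: ifP => _; nia.
Qed.

Lemma polyfun_best G wd (rho : seq (G -> nat)) : polyfun wd rho (fun g => best (wd g)).
Proof.
have pi := polyfun_idx wd rho; have pj := polyfun_idx (xwd wd) (xrho rho).
exact: (polyfun_argbest (polyfun_argbest (polyfun_cand (polyfun_weak pi) pj))).
Qed.

Lemma polyout_solution_word : polyout id [::] solution_word.
Proof.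
have pb := polyfun_best id [::]; have pbx := polyfun_weak pb.
have pi := polyfun_idx id [::]; have ps := polyfun_scale (xwd id) (xrho [::]).
have pfr := polyfun_front pbx (polyfun_succ pi).
apply: (polyout_cat (polyout_write (polyfun_nrepl pb))).
have pw := polyout_write ps.
have pst := polyout_cat (polyout_write (polyfun_latest pbx pi)) pw.
have pu := polyout_write (polyfun_sub pfr (polyfun_const _ _ 1)).
have prp := polyout_when (polyfun_ltn pfr (polyfun_horizon pbx)) (polyout_cat pu pw).
exact: polyout_cat (polyout_for pst) (polyout_for prp).
Qed.

(** * Correctness *)

(** As [k < njob w], the key of [k] is below [(rtime w k).+1 * njob w]. *)
Lemma leq_key_rtime w j k : k < njob w -> key w j <= key w k -> rtime w j <= rtime w k.
Proof. by rewrite /key; nia. Qed.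

Lemma key_inj w i j : i < njob w -> j < njob w -> key w i = key w j -> i = j.
Proof.
move=> lt_i lt_j eq_k; have ei : key w i %% njob w = i by rewrite /key modnMDl modn_small.
by rewrite -ei eq_k /key modnMDl modn_small.
Qed.

Lemma leq_rtotal w j : j < njob w -> rtime w j <= rtotal w.
Proof. by move=> lt_j; rewrite /rtotal (bigD1 (Ordinal lt_j)) //= leq_addr. Qed.

Lemma leq_load_self w j : j < njob w -> ptime w j <= load w j j.
Proof. by move=> lt_j; rewrite /load (bigD1 (Ordinal lt_j)) //= leqnn leq_addr. Qed.

Lemma leq_load w i j k : i < njob w -> key w i < key w j -> key w j <= key w k ->
  ptime w i + load w j k <= load w i k.
Proof.
move=> lt_i lt_ij le_jk; rewrite /load !(bigD1 (Ordinal lt_i) (P := predT)) //=.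
rewrite leqnn [key w j <= _]leqNgt lt_ij /= (leq_trans (ltnW lt_ij) le_jk) /= add0n leq_add2l.
apply: leq_sum => l _; case: (key w j <= key w l) / idP => //= le_jl.
by rewrite (leq_trans (ltnW lt_ij) le_jl).
Qed.

Lemma leq_tail w j k : k < njob w -> key w j <= key w k ->
  load w j k + (rtotal w - rtime w k) <= tail w j.
Proof.
move=> lt_k le_jk; have := leq_bigmax (F := fun k : 'I_(njob w) =>
  if key w j <= key w k then load w j k + (rtotal w - rtime w k) else 0) (Ordinal lt_k).
by rewrite /= le_jk.
Qed.

Lemma tail_attained w j : j < njob w -> exists2 k, k < njob w &
  key w j <= key w k /\ tail w j = load w j k + (rtotal w - rtime w k).
Proof.
move=> lt_j; have := leq_tail lt_j (leqnn (key w j)).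
have [|k eq_k] := @eq_bigmax 'I_(njob w) (fun k : 'I_(njob w) =>
  if key w j <= key w k then load w j k + (rtotal w - rtime w k) else 0).
  by rewrite card_ord (leq_ltn_trans _ lt_j).
rewrite -/(tail w j) in eq_k; case: ifP eq_k => le_jk eq_k ge_j.
  by exists k.
(* The maximum is attained by a placeholder 0, so [tail w j] is 0, and by [ge_j] the job [j] itself
   attains it too. *)
by exists j => //; split=> //; lia.
Qed.

Lemma leq_tail_self w j : j < njob w -> ptime w j + (rtotal w - rtime w j) <= tail w j.
Proof.
move=> lt_j; apply: leq_trans (leq_tail lt_j (leqnn _)).
by rewrite leq_add2r leq_load_self.
Qed.

(** The job attaining [tail w j] also competes in [tail w i], with a load larger by at least
    [ptime w i]. Hence jobs started at their [latest] times do not overlap. *)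
Lemma leq_tail_step w i j : i < njob w -> j < njob w -> key w i < key w j ->
  ptime w i + tail w j <= tail w i.
Proof.
move=> lt_i lt_j lt_ij; have [k lt_k [le_jk ->]] := tail_attained lt_j.
apply: leq_trans (leq_tail lt_k (leq_trans (ltnW lt_ij) le_jk)).
by rewrite addnA leq_add2r leq_load.
Qed.

Lemma leq_flow0 w j : j < njob w -> flow w j j <= flow0 w.
Proof. by move=> lt_j; apply: (leq_bigmax (F := fun k : 'I__ => flow w k k) (Ordinal lt_j)). Qed.

(** * Latest start times and greedy stabbing for a fixed flow time *)

Section Greedy.
Variables (w : seq nat) (F : nat).
Hypothesis le_F : flow0 w <= F.
Local Notation n := (njob w).

Lemma rtime_tail j : j < n -> rtime w j + tail w j <= F + rtotal w.
Proof. by move/leq_flow0; rewrite /flow; lia. Qed.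

Lemma leq_rtime_latest j : j < n -> rtime w j <= latest w F j.
Proof. by move/rtime_tail; rewrite /latest; lia. Qed.

Lemma latest_step i j : i < n -> j < n -> key w i < key w j ->
  latest w F i + ptime w i <= latest w F j.
Proof.
move=> lt_i lt_j /(leq_tail_step lt_i lt_j).
by have := rtime_tail lt_i; rewrite /latest; lia.
Qed.

Lemma latest_flow j : j < n -> latest w F j + ptime w j <= F + rtime w j.
Proof.
move=> lt_j; have := leq_tail_self lt_j; have := leq_rtotal lt_j.
by have := rtime_tail lt_j; rewrite /latest; lia.
Qed.

Lemma latest_horizon j : (latest w F j).+1 < horizon w F.
Proof. by rewrite /latest /horizon; lia. Qed.

Lemma leq_advance v j : j < n -> v <= rtime w j -> advance w F v <= (latest w F j).+1.
Proof.
rewrite /advance; elim: n => //= k IH; rewrite ltnS leq_eqVlt => /orP[/eqP->|lt_j] le_v.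
  by rewrite le_v /=; case: ifP => //; lia.
by case: ifP => [/andP[_]|_]; have := IH lt_j le_v; lia.
Qed.

Lemma advance_attained v : advance w F v < horizon w F ->
  exists2 j, j < n & v <= rtime w j /\ advance w F v = (latest w F j).+1.
Proof.
rewrite /advance; elim: n => [|k IH] /=; first by rewrite ltnn.
case: ifP => [/andP[le_v _] _|_ /IH[j lt_j ?]]; first by exists k.
by exists j => //; apply: ltnW.
Qed.

Lemma frontS m : m < n -> front w F m.+1 = advance w F (front w F m).
Proof.
have frontE k : k <= n -> front w F k = iter k (advance w F) 0.
  (* For the induction: after [l] rounds of the loop, [advance] has been applied [minn l k]
     times. *)
  rewrite /front => le_kn; rewrite -{2}(minn_idPr le_kn).
  elim: {le_kn}n => [|l IH] /=; first by rewrite min0n.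
  rewrite IH; case: ltnP => h; first by rewrite (minn_idPl h).
  by rewrite (minn_idPr (leqW h)).
by move=> lt_m; rewrite !frontE //= ltnW.
Qed.

Lemma front0 : front w F 0 = 0.
Proof. by rewrite /front; elim: n => //= k ->. Qed.

Lemma ltn_frontS m : m < n -> front w F m.+1 < horizon w F -> front w F m < front w F m.+1.
Proof.
move=> lt_m; rewrite frontS // => /advance_attained[j lt_j [le_v ->]].
by rewrite ltnS (leq_trans le_v) // leq_rtime_latest.
Qed.

Lemma front_horizon m : m <= n -> front w F m <= horizon w F.
Proof. by case: m => [|m] lt_m; rewrite ?front0 // frontS // advance_horizon. Qed.

Lemma leq_front m k : m <= k -> k <= n -> front w F m <= front w F k.
Proof.
elim: k => [|k IH]; first by rewrite leqn0 => /eqP->.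
rewrite leq_eqVlt => /orP[/eqP->//|le_m lt_k].
apply: leq_trans (IH le_m (ltnW lt_k)) _.
have [/ltn_frontS/ltnW|] := ltnP (front w F k.+1) (horizon w F); first exact.
by apply: leq_trans; apply: front_horizon (ltnW lt_k).
Qed.

(** As long as some job is unserved, a step serves the job attaining the minimum, as its release
    date is at most its [latest]. So the set [A m] of unserved jobs loses an element in every step
    until it is empty. *)
Lemma front_final j : j < n -> rtime w j < front w F n.
Proof.
pose A m := [set j : 'I_n | front w F m <= rtime w j].
suff cardA m : m <= n -> #|A m| <= n - m.
  move=> lt_j; rewrite ltnNge; apply/negP => le_j.
  have: #|A n| = 0 by apply/eqP; rewrite -leqn0 -(subnn n) cardA.
  by move/cards0_eq/setP/(_ (Ordinal lt_j)); rewrite !inE le_j.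
elim: m => [|m IH] lt_m; first by rewrite subn0 -[X in _ <= X]card_ord max_card.
have sub : A m.+1 \subset A m.
  apply/subsetP => i; rewrite !inE; apply: leq_trans.
  exact: leq_front.
have [A0|[i]] := set_0Vmem (A m); first by rewrite (leq_trans (subset_leq_card sub)) // A0 cards0.
rewrite inE => le_i; have lt_advance : advance w F (front w F m) < horizon w F.
  exact: leq_ltn_trans (leq_advance (ltn_ord i) le_i) (latest_horizon i).
have [k lt_k [le_k eq_k]] := advance_attained lt_advance.
suff: A m.+1 \proper A m by move/proper_card; have := IH (ltnW lt_m); lia.
apply/properP; split=> //; exists (Ordinal lt_k); rewrite !inE //=.
by rewrite frontS // eq_k -ltnNge ltnS leq_rtime_latest.
Qed.

(** Take the step in which [j] becomes served, where the front passes [rtime w j]. Before it [j]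
    competed in the minimum, so the point chosen is at most [latest w F j]. *)
Lemma front_stabs j : j < n -> exists2 m, m < n &
  front w F m.+1 < horizon w F /\ rtime w j <= front w F m.+1 - 1 <= latest w F j.
Proof.
move=> lt_j.
suff: exists2 m, m < n & front w F m <= rtime w j < front w F m.+1.
  case=> m lt_m /andP[le_m gt_m]; exists m => //.
  have := leq_advance lt_j le_m; rewrite -frontS //.
  by have := latest_horizon j; lia.
have ex k : k <= n -> rtime w j < front w F k ->
    exists2 m, m < n & front w F m <= rtime w j < front w F m.+1.
  elim: k => [|k IH] lt_k; first by rewrite front0.
  move=> gt_f; have [lt_f|le_f] := ltnP (rtime w j) (front w F k).
    exact: IH (ltnW lt_k) lt_f.
  by exists k => //; rewrite le_f.
exact: ex (leqnn n) (front_final lt_j).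
Qed.

(** Each greedy point is the right end of an interval that starts at or after the previous front. A
    point of [Z] in this interval lies between the two fronts, hence is counted for no other
    step. *)
Lemma leq_nrepl (Z : seq nat) :
  (forall j, j < n -> exists2 u, u \in Z & rtime w j <= u <= latest w F j) ->
  nrepl w F <= size Z.
Proof.
move=> stab; rewrite /nrepl.
suff: forall m, m <= n -> \sum_(i < m) (front w F i.+1 < horizon w F) <=
    count (ltn^~ (front w F m)) Z.
  by move=> H; apply: leq_trans (H _ (leqnn n)) (count_size _ _).
elim=> [|m IH] lt_m; first by rewrite big_ord0.
have sub : subpred (ltn^~ (front w F m)) (ltn^~ (front w F m.+1)).
  by move=> u /leq_trans; apply; apply: leq_front.
rewrite big_ord_recr /=; case: (ltnP _ (horizon w F)) => [lt_h|_]; last first.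
  by rewrite addn0; apply: leq_trans (IH (ltnW lt_m)) (sub_count sub _).
have [] := @advance_attained (front w F m); first by rewrite -frontS.
move=> j lt_j [le_v eq_v]; have [u uZ /andP[ge_u le_u]] := stab j lt_j.
rewrite -frontS // in eq_v.
apply: leq_trans (_ : (count (ltn^~ (front w F m)) Z).+1 <= _).
  by rewrite addn1 ltnS IH // ltnW.
have := count_predUI (ltn^~ (front w F m)) (pred1 u) Z.
have -> : count (predI (ltn^~ (front w F m)) (pred1 u)) Z = 0.
  apply/eqP; rewrite -leqn0 leqNgt -has_count; apply/hasP => -[y _ /= /andP[lt_y /eqP eq_y]].
  by move: lt_y; rewrite eq_y; lia.
have : 0 < count (pred1 u) Z by rewrite -has_count has_pred1.
have : count (predU (ltn^~ (front w F m)) (pred1 u)) Z <= count (ltn^~ (front w F m.+1)) Z.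
  apply: sub_count => y /orP[/sub//|/eqP-> /=]; rewrite eq_v; lia.
move=> leU; rewrite addn0 => ge1 eqU; apply: leq_trans leU.
by rewrite eqU -addn1 leq_add2l.
Qed.

End Greedy.

Lemma leq_argbest w f : (forall i, flow0 w <= f i) -> flow0 w <= argbest w f.
Proof. by move=> le_f; rewrite /argbest; elim: (njob w) => //= n IH; case: ifP. Qed.

Lemma price_argbest0 w f : price w (argbest w f) <= price w (flow0 w).
Proof. by rewrite /argbest; elim: (njob w) => //= n IH; case: ifP => //; lia. Qed.

Lemma price_argbest w f i : i < njob w -> price w (argbest w f) <= price w (f i).
Proof.
rewrite /argbest; elim: (njob w) => //= n IH.
rewrite ltnS leq_eqVlt => /orP[/eqP->|/IH le_i]; case: ifP => //; lia.
Qed.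

Lemma flow0_best w : flow0 w <= best w.
Proof. by apply: leq_argbest => k; apply: leq_argbest => i; apply: leq_maxl. Qed.

Lemma price_best0 w : price w (best w) <= price w (flow0 w).
Proof. exact: price_argbest0. Qed.

Lemma price_best w k i : k < njob w -> i < njob w ->
  price w (best w) <= price w (cand w k i).
Proof.
move=> lt_k lt_i; apply: leq_trans (price_argbest (argbest w \o cand w) lt_k) _.
exact: price_argbest.
Qed.

(** * Encoded instances as integral data over a common denominator *)

Import Order.TTheory GRing.Theory Num.Theory.
Local Open Scope ring_scope.

Definition pairs_word (f : seq (nat * nat)) : seq nat :=
  flatten [seq [:: a.1; a.2] | a <- f].

Lemma size_pairs_word f : size (pairs_word f) = (2 * size f)%N.
Proof. by elim: f => //= a f; rewrite /pairs_word /= => ->; lia. Qed.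

Lemma nth_pairs_word f i :
  nth 0%N (pairs_word f) (2 * i) = (nth (0%N, 0%N) f i).1 /\
  nth 0%N (pairs_word f) (2 * i).+1 = (nth (0%N, 0%N) f i).2.
Proof.
elim: f i => [|a f IH] [|i]; rewrite ?nth_nil //.
by rewrite mulnS -[nth _ (a :: f) _]/(nth (0%N, 0%N) f i); exact: IH.
Qed.

Lemma dvdn_scale w i : (i < 2 + njob w + njob w)%N -> (dnm w i %| scale w)%N.
Proof.
move=> lt_i; rewrite /scale; case: i lt_i => [|[|i]] lt_i.
- by rewrite -mulnA dvdn_mulr.
- by rewrite -mulnA mulnCA dvdn_mulr.
- apply: dvdn_mull; have [lt_in|ge_in] := ltnP i (njob w).
    by rewrite (bigD1 (Ordinal lt_in)) //= -mulnA dvdn_mulr.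
  have lt_in : (i - njob w < njob w)%N by lia.
  rewrite (bigD1 (Ordinal lt_in)) //= -mulnA mulnCA dvdn_mulr //.
  have -> : (2 + njob w + (i - njob w) = i.+2)%N by lia.
  exact: dvdnn.
Qed.

Section Encoding.
Variables (R : realFieldType) (x : instance R) (w : seq nat).
Hypothesis enc : enc_instance x w.

Lemma enc_njob : njob w = njobs x.
Proof. by case: enc => u _ ->. Qed.

Lemma enc_size : size w = (4 * njob w + 5)%N.
Proof.
rewrite enc_njob; case: enc => u [f [_ eq_v ->] ->] /=.
have := congr1 size eq_v; rewrite size_map /= size_cat !size_codom card_ord.
by rewrite -/(pairs_word f) size_pairs_word; lia.
Qed.

Lemma enc_dnm i : (i < 2 + njob w + njob w)%N -> (0 < dnm w i)%N.
Proof.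
rewrite enc_njob; case: enc => u [f [f_gt0 eq_v ->] ->] lt_i.
have sf := congr1 size eq_v; rewrite size_map /= size_cat !size_codom card_ord in sf.
rewrite /dnm /= (nth_pairs_word f i).2; apply: (allP f_gt0); apply: mem_nth; rewrite -sf; lia.
Qed.

Lemma enc_scale : (0 < scale w)%N.
Proof.
rewrite /scale !muln_gt0 !enc_dnm; try lia.
apply: prodn_gt0 => j; rewrite muln_gt0 !enc_dnm //; have := ltn_ord j; lia.
Qed.

(** The division in [scaled] is exact, because [dnm w i] divides [scale w]. *)
Lemma enc_value i : (i < 2 + njob w + njob w)%N ->
  nth 0 ([:: K0 x; K1 x] ++ codom (@proc R x) ++ codom (@release R x)) i =
  (scaled w i)%:R / (scale w)%:R.
Proof.
move=> lt_i; have d_gt0 := enc_dnm lt_i; have := dvdn_scale lt_i.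
move=> /divnK; have := enc_scale.
rewrite /scaled; move: (scale w) => D D_gt0 eD.
have -> : (num w i * (D %/ dnm w i))%:R / D%:R = (num w i)%:R / (dnm w i)%:R :> R.
  have q_gt0 : (0 < D %/ dnm w i)%N by case: (posnP (D %/ dnm w i)) eD => // ->; lia.
  rewrite -{2}eD !natrM; field; rewrite !pnatr_eq0 -!lt0n d_gt0.
  by rewrite q_gt0.
move: lt_i {d_gt0 eD}; rewrite enc_njob; case: enc => u [f [f_gt0 eq_v ->] ->] lt_i.
have sf := congr1 size eq_v; rewrite size_map /= size_cat !size_codom card_ord in sf.
rewrite eq_v (nth_map (0%N, 0%N)); last by rewrite -sf; lia.
by rewrite /num /dnm /= (nth_pairs_word f i).1 (nth_pairs_word f i).2.
Qed.

Lemma nth_codom_ord n (T : Type) (x0 : T) (h : 'I_n -> T) (j : 'I_n) :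
  nth x0 (codom h) j = h j.
Proof. by rewrite codomE (nth_map j) ?size_enum_ord // nth_ord_enum. Qed.

Lemma enc_proc (j : 'I_(njobs x)) : proc j = (ptime w j)%:R / (scale w)%:R :> R.
Proof.
have := ltn_ord j; rewrite -{2}enc_njob => lt_j; rewrite -enc_value; last lia.
by rewrite /= nth_cat size_codom card_ord ltn_ord nth_codom_ord.
Qed.

Lemma enc_release (j : 'I_(njobs x)) : release j = (rtime w j)%:R / (scale w)%:R :> R.
Proof.
have := ltn_ord j; rewrite -{2}enc_njob => lt_j; rewrite -enc_value; last lia.
rewrite /= nth_cat size_codom card_ord enc_njob ltnNge leq_addr /= addKn.
by rewrite nth_codom_ord.
Qed.

Lemma enc_unit_cost : K0 x + K1 x = (unit_cost w)%:R / (scale w)%:R.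
Proof. by rewrite /unit_cost natrD mulrDl -!enc_value. Qed.

End Encoding.

Lemma ex_max_seq (s : seq nat) (P : pred nat) x0 : x0 \in s -> P x0 ->
  exists v, [/\ v \in s, P v & forall y, y \in s -> P y -> (y <= v)%N].
Proof.
move=> sx0 Px0.
have exP : exists v, (v \in s) && P v by exists x0; rewrite sx0.
have ubP v : (v \in s) && P v -> (v <= \max_(y <- s) y)%N.
  by move=> /andP[sv _]; apply: leq_bigmax_seq.
case: (ex_maxnP exP ubP) => v /andP[sv Pv] maxv.
by exists v; split=> // y sy Py; apply: maxv; rewrite sy.
Qed.

(** * Lower bound on the cost of an arbitrary feasible solution *)

Section LowerBound.
Variables (R : realFieldType) (x : instance R) (z : solution x).
Hypothesis feas : feasible z.

Lemma completion_le_Fmax j : completion z j <= Fmax z + release j.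
Proof. by rewrite -lerBlDr /Fmax (bigD1 j) //= le_max lexx. Qed.

Lemma Fmax_ge0 : 0 <= Fmax z.
Proof. by rewrite /Fmax; elim/big_rec: _ => // i u _ u_ge0; rewrite le_max u_ge0 orbT. Qed.

(* The job of the set started last completes last. *)
Lemma busy_interval (A : {set 'I_(njobs x)}) j : j \in A ->
  exists l m, [/\ l \in A, m \in A &
    start z l + \sum_(i in A) proc i <= completion z m].
Proof.
have [k] := ubnP #|A|; elim: k A j => // k IH A j leA jA.
have [m mA maxm] := @arg_maxP _ _ _ j [in A] (start z) jA.
have [A1|[i iA]] := set_0Vmem (A :\ m).
  exists m, m; split=> //; rewrite (big_setD1 m) //= A1 big_set0 addr0.
  exact: lexx.
have cardA : (#|A :\ m| < k)%N by move: leA; rewrite (cardsD1 m A) mA; lia.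
have [l [m' [lA m'A le_m']]] := IH _ _ cardA iA.
move: lA m'A; rewrite !inE => /andP[_ lA] /andP[m'm m'A].
exists l, m; split=> //; rewrite (big_setD1 m) //=.
have [_ /(_ _ _ m'm) disj _] := feas.
have le_s : start z m' <= start z m := maxm _ m'A.
have := proc_gt0 m.
(* Either [m'] precedes [m], and the bound extends by [proc m], or [m] precedes [m'], which is
   impossible as [m] starts last and has positive length. *)
by case: disj; rewrite /completion in le_m' *; lra.
Qed.

Variable w : seq nat.
Hypothesis enc : enc_instance x w.
Local Notation D := ((scale w)%:R : R).

Let D_gt0 : 0 < D.
Proof. by rewrite ltr0n (enc_scale enc). Qed.

(* Among the jobs from [j] to the one attaining [tail w j], the first to start
   has a replenishment after its release and before [latest]. *)
Lemma repl_stabs j : (j < njob w)%N -> exists2 u, u \in repl z &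
  (rtime w j)%:R <= D * u /\
  D * u + (tail w j)%:R <= D * Fmax z + (rtotal w)%:R.
Proof.
move=> lt_j; have [k lt_k [le_jk ->]] := tail_attained lt_j.
have eqn := enc_njob enc.
move: lt_j lt_k (leq_rtotal lt_k); rewrite eqn => lt_j lt_k le_k.
pose A := [set l : 'I_(njobs x) | (key w j <= key w l)%N && (key w l <= key w k)%N].
have jA : Ordinal lt_j \in A by rewrite inE leqnn.
have [l [m [lA mA]]] := busy_interval jA.
have [_ _ /(_ l)[u uz /andP[ge_u le_u]] le_m] := feas.
move: lA mA; rewrite !inE => /andP[jl _] /andP[_ mk].
have sumA : \sum_(i in A) proc i = (load w j k)%:R / D.
  rewrite /load eqn natr_sum mulr_suml big_mkcond /=; apply: eq_bigr => i _.
  by rewrite inE; case: ifP => _; rewrite ?mul0r // (enc_proc enc).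
exists u => //; split.
  apply: (@le_trans _ _ (rtime w l)%:R).
    by rewrite ler_nat; apply: leq_key_rtime jl; rewrite eqn.
  by rewrite mulrC -ler_pdivrMr // -(enc_release enc).
have := completion_le_Fmax m; rewrite sumA in le_m.
have rk : release m <= (rtime w k)%:R / D.
  rewrite (enc_release enc) ler_pM2r ?invr_gt0 // ler_nat.
  by apply: leq_key_rtime mk; rewrite eqn.
(* All jobs of [A] fit between [u] and the completion of [m], which is released no later than
   [k]. *)
move=> cm; have le_uF : u + (load w j k)%:R / D <= Fmax z + (rtime w k)%:R / D by lra.
rewrite natrD natrB //; move: le_uF; rewrite -(ler_pM2l D_gt0) !mulrDr.
by rewrite ![D * (_ / D)]mulrC !divfK ?gt_eqF //; lra.
Qed.

(** For every job, the replenishment from [repl_stabs] witnesses that its interval for the flow time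
    of [z] is nonempty. *)
Lemma flow0_le_Fmax : (flow0 w)%:R <= D * Fmax z.
Proof.
rewrite /flow0; elim/big_rec: _ => [|k y _ le_y].
  by rewrite mulr_ge0 ?Fmax_ge0 // ltW.
rewrite /maxn; case: ifP => // _; rewrite /flow.
have [u _ [ge_u le_u]] := repl_stabs (ltn_ord k).
have [le_T|/ltnW le_T] := leqP (rtime w k + tail w k) (rtotal w).
  by move: le_T; rewrite -subn_eq0 => /eqP->; rewrite mulr_ge0 ?Fmax_ge0 // ltW.
by rewrite natrB // natrD; lra.
Qed.

(** Let [Fs] be the largest candidate not exceeding the scaled flow time of [z]. Lowering the flow
    time to [Fs] does not call for more replenishments than [z] has, so [price w Fs] is at most the
    scaled cost of [z]. *)
Lemma price_best_le : (price w (best w))%:R <= D * cost z.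
Proof.
have F_ge0 : 0 <= D * Fmax z by rewrite mulr_ge0 ?Fmax_ge0 // ltW.
have [Fs [le_Fs ge0_Fs price_Fs flow_Fs]] : exists Fs, [/\ Fs%:R <= D * Fmax z,
    (flow0 w <= Fs)%N, (price w (best w) <= price w Fs)%N &
    forall k i, (k < njob w)%N -> (i < njob w)%N ->
      (flow w k i)%:R <= D * Fmax z -> (flow w k i <= Fs)%N].
  pose s := flow0 w :: [seq cand w k i | k <- iota 0 (njob w), i <- iota 0 (njob w)].
  have [Fs [sF le_F max_F]] :=
    @ex_max_seq s (fun v => v%:R <= D * Fmax z) _ (mem_head _ _) flow0_le_Fmax.
  exists Fs; split=> //.
  - by apply: max_F flow0_le_Fmax; apply: mem_head.
  - move: sF; rewrite inE => /orP[/eqP->|/allpairsP[[k i] /= [kn i_n ->]]].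
      exact: price_best0.
    by move: kn i_n; rewrite !mem_iota => kn i_n; apply: price_best.
  - move=> k i lt_k lt_i le_f; apply: leq_trans (leq_maxr (flow0 w) _) (max_F _ _ _).
      rewrite inE; apply/orP; right; apply: allpairs_f; rewrite mem_iota //.
    (* Raising a threshold to [flow0 w] keeps it below the flow time of [z], so the maximality of
       [Fs] applies to the candidate. *)
    by rewrite /maxn; case: ifP => // _; apply: flow0_le_Fmax.
(* Moves a replenishment back to the last release date not after it. The new point still lies after
   the release of every job it served. *)
pose rnd (u : R) := (\max_(i < njob w | ((rtime w i)%:R <= D * u)%R) rtime w i)%N.
have le_n : (nrepl w Fs <= size (repl z))%N.
  rewrite -(size_map rnd); apply: leq_nrepl => // j lt_j.
  have [u uz [ge_u le_u]] := repl_stabs lt_j.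
  exists (rnd u); first exact: map_f.
  rewrite /rnd; apply/andP; split.
    exact: (@leq_bigmax_cond _ (fun i : 'I_(njob w) => (rtime w i)%:R <= D * u)
      (fun i => rtime w i) (Ordinal lt_j)).
  have [|i le_i ->] := @eq_bigmax_cond _ [pred i : 'I_(njob w) | (rtime w i)%:R <= D * u]
      (fun i : 'I_(njob w) => rtime w i).
    by apply/card_gt0P; exists (Ordinal lt_j).
  rewrite inE in le_i.
  (* The rounded point is [rtime w i], and it is in time for [j] at the flow time of [z]; the
     threshold [flow w j i] for this is thus at most [Fs]. *)
  have: (flow w j i <= Fs)%N.
    apply: flow_Fs => //; rewrite /flow.
    have [le_T|/ltnW le_T] := leqP (rtime w i + tail w j) (rtotal w).
      by move: le_T; rewrite -subn_eq0 => /eqP->.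
    by rewrite natrB // natrD; lra.
  by rewrite /flow /latest; lia.
apply: (@le_trans _ _ (price w Fs)%:R); first by rewrite ler_nat.
rewrite /price /cost natrD natrM mulrDr (enc_unit_cost enc) lerD //.
rewrite mulrCA [D * _]mulrC divfK ?gt_eqF //.
by rewrite ler_wpM2r ?ler0n // ler_nat.
Qed.

End LowerBound.

(** * The computed solution: feasibility, cost and encoding *)

Section Output.
Variables (R : realFieldType) (x : instance R) (w : seq nat).
Hypothesis enc : enc_instance x w.
Local Notation D := ((scale w)%:R : R).
Local Notation n := (njob w).
Local Notation F := (best w).

Definition repl_times : seq nat :=
  [seq (front w F m.+1 - 1)%N | m <- iota 0 n & (front w F m.+1 < horizon w F)%N].

Definition best_solution : solution x :=
  Solution (fun j => (latest w F j)%:R / D) [seq u%:R / D | u <- repl_times].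

Let D_gt0 : 0 < D.
Proof. by rewrite ltr0n (enc_scale enc). Qed.

Let le_div (a b : nat) : (a%:R / D <= b%:R / D) = (a <= b)%N.
Proof. by rewrite ler_pM2r ?invr_gt0 // ler_nat. Qed.

Lemma size_repl_times : size repl_times = nrepl w F.
Proof.
rewrite size_map size_filter /nrepl -sum1_count big_mkcond /=.
have -> : iota 0 n = index_iota 0 n by rewrite /index_iota subn0.
by rewrite big_mkord.
Qed.

Lemma sorted_repl_times : sorted ltn repl_times.
Proof.
rewrite /repl_times sorted_map; set P := fun m => (_ < _)%N.
have le_F := flow0_best w.
have: all (fun m => (m < n)%N && P m) [seq m <- iota 0 n | P m].
  by apply/allP => m; rewrite mem_filter mem_iota => /andP[-> /andP[_ ->]].
move=> allP; apply: (sub_in_sorted _ allP) (sorted_filter ltn_trans _ (iota_ltn_sorted 0 n)).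
move=> m k /andP[lt_m Pm] /andP[lt_k Pk] lt_mk /=.
have := ltn_frontS le_F lt_k Pk.
have := leq_front le_F lt_mk (ltnW lt_k).
(* Makes [front w F m.+1] positive, so that the subtraction of 1 preserves strict inequality. *)
have := ltn_frontS le_F lt_m Pm; lia.
Qed.

Lemma best_solution_feasible : feasible best_solution.
Proof.
have le_F := flow0_best w; have eqn := enc_njob enc.
have ltn_job (j : 'I_(njobs x)) : (j < n)%N by rewrite eqn.
split.
- rewrite /= sorted_map; apply: sub_sorted sorted_repl_times => a b /= lt_ab.
  by rewrite ltr_pM2r ?invr_gt0 // ltr_nat.
- have step (i j : 'I_(njobs x)) : (key w i < key w j)%N ->
      completion best_solution i <= start best_solution j.
    move=> lt_ij; rewrite /completion /= (enc_proc enc) -mulrDl -natrD le_div.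
    exact: latest_step.
  move=> i j ij; have [/step|/step|] := ltngtP (key w i) (key w j); [by left|by right|].
  move/key_inj => /(_ (ltn_job i) (ltn_job j)) /val_inj eq_ij.
  by rewrite eq_ij eqxx in ij.
- move=> j; have [m lt_m [Pm /andP[ge_j le_j]]] := front_stabs le_F (ltn_job j).
  exists ((front w F m.+1 - 1)%N%:R / D).
    apply: map_f; apply: map_f; rewrite mem_filter mem_iota.
    by rewrite Pm lt_m.
  by rewrite (enc_release enc) !le_div ge_j.
Qed.

(** An upper bound suffices, since [price_best_le] bounds the cost of every feasible solution from
    below by the same price. *)
Lemma best_solution_cost : D * cost best_solution <= (price w F)%:R.
Proof.
have le_F := flow0_best w; have eqn := enc_njob enc.
rewrite /cost /price natrD natrM mulrDr lerD //.
  rewrite mulrC -ler_pdivlMr // /Fmax; elim/big_rec: _ => [|j u _ le_u].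
    by rewrite divr_ge0 ?ler0n.
  rewrite ge_max le_u andbT /completion /= (enc_proc enc) (enc_release enc).
  rewrite lerBlDr -!mulrDl -!natrD le_div.
  by apply: latest_flow; rewrite ?eqn.
rewrite (enc_unit_cost enc) mulrCA [D * _]mulrC divfK ?gt_eqF //.
by rewrite /= size_map size_repl_times.
Qed.

Lemma best_solution_optimal : optimal best_solution.
Proof.
split=> [|z feas]; first exact: best_solution_feasible.
rewrite -(ler_pM2l D_gt0); apply: le_trans best_solution_cost _.
exact: price_best_le.
Qed.

Lemma best_solution_enc : enc_solution best_solution (solution_word w).
Proof.
have eqn := enc_njob enc; have sc := enc_scale enc.
pose f := [seq (latest w F j, scale w) | j <- iota 0 n] ++
          [seq (u, scale w) | u <- repl_times].
exists (pairs_word f); last first.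
  rewrite /solution_word; congr (_ :: _).
    by rewrite /= size_map size_repl_times.
  rewrite /pairs_word /f map_cat flatten_cat -!map_comp; congr (_ ++ _).
  rewrite /repl_times; elim: (iota 0 n) => //= m s ->.
  by case: ifP.
exists f; split=> //.
  rewrite all_cat !all_map; apply/andP; split; apply/allP => ? _ /=; exact: sc.
rewrite /f map_cat -!map_comp; congr (_ ++ _); last by rewrite /= /repl_times -map_comp.
rewrite codomE -val_enum_ord -map_comp eqn.
by apply: eq_map.
Qed.

End Output.

Theorem theorem7 (R : realFieldType) :
  @poly_time_solvable (instance R) (@solution R)
    (@enc_instance R) (@enc_solution R) (@optimal R).
Proof.
have [c [k run]] := polyout_run polyout_solution_word.
exists c, k => x w enc; have [s [t [E le_t eq_out]]] := run w (enc_size enc).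
exists s, t, (best_solution x w); split=> //; last exact: best_solution_optimal.
rewrite eq_out; exact: best_solution_enc.
Qed.
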